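(* Let $\mathcal{H}$ be a complex Hilbert space and let $T\in\boldsymbol{B}(\mathcal{H})$. Then the following statements are equivalent: (i) $T$ is normal; (ii) $T$ and $T^*$ are CPD and have the same representing triplets.
   Context: $\boldsymbol{B}(\mathcal{H})$ denotes the bounded linear operators on $\mathcal{H}$; $\mathbb{R}_+=[0,\infty)$; $\mathbb{Z}_+$ is the set of nonnegative integers; $\mathfrak{B}(\mathbb{R}_+)$ is the Borel $\sigma$-algebra of $\mathbb{R}_+$. A semispectral measure is a map $F\colon\mathfrak{B}(\mathbb{R}_+)\to\boldsymbol{B}(\mathcal{H})$ such that $\langle F(\cdot)f,f\rangle$ is a positive measure for every $f\in\mathcal{H}$ (it is not assumed that $F(\mathbb{R}_+)=I$). For a Borel function $f$ that is integrable with respect to $\langle F(\cdot)h,h\rangle$ for all $h\in\mathcal{H}$, $\int_{\mathbb{R}_+}f\,dF$ is the unique operator in $\boldsymbol{B}(\mathcal{H})$ with $\langle\int_{\mathbb{R}_+} f\,dF\,h,h\rangle=\int_{\mathbb{R}_+} f(x)\langle F(dx)h,h\rangle$ for all $h\in\mathcal{H}$. A real sequence $\{\gamma_k\}_{k=0}^{\infty}$ is conditionally positive definite (CPD) if $\sum_{i,j=0}^{k}\gamma_{i+j}\lambda_i\bar\lambda_j\geq0$ for every $k\in\mathbb{Z}_+$ and all $\lambda_0,\dots,\lambda_k\in\mathbb{C}$ with $\sum_{i=0}^k\lambda_i=0$. $T\in\boldsymbol{B}(\mathcal{H})$ is CPD if $\{\|T^kh\|^2\}_{k=0}^\infty$ is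 CPD for every $h\in\mathcal{H}$. It is known that $T$ is CPD if and only if there exist $B,C\in\boldsymbol{B}(\mathcal{H})$ and a compactly supported semispectral measure $F\colon\mathfrak{B}(\mathbb{R}_+)\to\boldsymbol{B}(\mathcal{H})$ such that $B=B^*$, $C\geq0$, $F(\{1\})=0$ and $$T^{*n}T^n=I+nB+n^2C+\int_{\mathbb{R}_+}Q_n\,dF,\quad n\in\mathbb{Z}_+,$$ where $Q_0=Q_1=0$ and $Q_n(x)=\sum_{j=0}^{n-2}(n-j-1)x^j$ for $n\geq2$. The triplet $(B,C,F)$ is then unique and is called the representing triplet of $T$. *)

(* Defs.v *)
From HB Require Import structures.
From mathcomp Require Import all_boot all_order all_algebra.
From mathcomp Require Import all_classical all_reals all_analysis.
From mathcomp Require Import complex.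

Set Implicit Arguments.
Unset Strict Implicit.
Unset Printing Implicit Defensive.
Import Order.TTheory GRing.Theory Num.Theory.
Import numFieldNormedType.Exports.
Local Open Scope complex_scope.
Local Open Scope classical_set_scope.
Local Open Scope ring_scope.

(* A complex Hilbert space is a Banach space over R[i] whose norm is induced  *)
(* by an inner product; the form [dot] is linear in its first argument.       *)
Record hilbertType (R : realType) := HilbertType {
  hilbert_sort :> completeNormedModType R[i] ;
  dot : {dot hilbert_sort for Num.conj} ;
  dotE : forall x : hilbert_sort, dot x x = `|x| ^+ 2 }.

Section Operators.
Variables (R : realType) (H : hilbertType R).

Record bop := Bop {
  bop_fun :> {linear H -> H} ;
  bop_bounded : exists M : R, forall x : H, `|bop_fun x| <= M%:C * `|x| }.

HB.instance Definition _ := gen_eqMixin bop.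
HB.instance Definition _ := gen_choiceMixin bop.

Definition inner (x y : H) : R[i] := dot H x y.

(* The unique S in B(H) with <T x, y> = <x, S y>. By the Riesz representation *)
(* theorem it always exists, so the default value T of [xget] is irrelevant.  *)
Definition adjoint (T : bop) : bop :=
  xget T [set S : bop | forall x y, inner (T x) y = inner x (S y)].

Definition normal_op (T : bop) :=
  forall x, adjoint T (T x) = T (adjoint T x).

Definition selfadjoint (T : bop) := adjoint T = T.

Definition positive_op (T : bop) := forall h, 0 <= inner (T h) h.

Definition cpd_seq (g : nat -> R) :=
  forall (k : nat) (lam : 'I_k.+1 -> R[i]), \sum_i lam i = 0 ->
    0 <= \sum_(i < k.+1) \sum_(j < k.+1) (g (i + j)%N)%:C * lam i * Num.conj (lam j).

(* The norm of H takes its values in R[i]; these are real, hence [Re]. *)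
Definition cpd (T : bop) :=
  forall h, cpd_seq (fun k => complex.Re (`|iter k T h| ^+ 2)).

Definition Rplus : set R := `[0, +oo[.

(* The Borel sigma-algebra of [0, +oo[ is the trace of that of R. *)
Definition borel_Rplus (A : set R) := measurable A /\ A `<=` Rplus.

(* A map F from the Borel sets of [0, +oo[ to B(H) is encoded as a function   *)
(* on all of [set R], of which only the values on [borel_Rplus] are ever      *)
(* used. Likewise a positive measure on [0, +oo[ is given by a measure on R,  *)
(* of which only the trace on [0, +oo[ is used; it is finite because it has   *)
(* to take the values <F A h, h>.                                             *)
Definition scalar_measure (F : set R -> bop) (h : H)
    (mu : {finite_measure set R -> \bar R}) :=
  forall A, borel_Rplus A -> inner (F A h) h = (fine (mu A))%:C.

Definition semispectral (F : set R -> bop) :=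
  forall h, exists mu, scalar_measure F h mu.

Definition compactly_supported (F : set R -> bop) :=
  exists K : set R, [/\ compact K, K `<=` Rplus
    & forall h, F (Rplus `\` K) h = 0].

(* S is the integral of f with respect to F. For each h a measure mu as below *)
(* exists when F is semispectral, and its trace on [0, +oo[ is unique.        *)
Definition is_op_integral (F : set R -> bop) (f : R -> R) (S : bop) :=
  forall h mu, scalar_measure F h mu ->
    mu.-integrable Rplus (EFin \o f) /\
    inner (S h) h = (\int[mu]_(x in Rplus) f x)%:C.

Definition Qpol (n : nat) (x : R) : R :=
  \sum_(0 <= j < n.-1) (n - j - 1)%:R * x ^+ j.

Definition representing_triplet (T B C : bop) (F : set R -> bop) :=
  [/\ selfadjoint B, positive_op C,
      semispectral F /\ compactly_supported F,
      (forall h, F [set 1] h = 0)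
    & forall n : nat, exists2 S : bop, is_op_integral F (Qpol n) S
        & forall x, iter n (adjoint T) (iter n T x)
            = x + n%:R *: B x + (n ^ 2)%:R *: C x + S x].

End Operators.

(* Main.v *)
(** For a normal T put N = T*T. Then |T^k h|^2 = <N^k h, h>, whence T is even positive
    definite, and the same holds for T*, since TT* = N. Both operators have a triplet
    built from N alone: if E is the spectral measure of N and dG = (x - 1)^2 dE, then
    x^n = 1 + n (x - 1) + (x - 1)^2 Q_n(x) gives N^n = I + n (N - I) + \int Q_n dG.
    As Q_n(1) = n (n - 1) / 2, a possible atom of G at 1 is absorbed by taking
    C = G{1} / 2 and B = N - I - C. Conversely, for n = 1 equal triplets force T*T = TT*.

    The scalar measures mu_h = <E(.) h, h> solve the Hausdorff moment problem for
    <N^j h, h>: with 0 <= A = N / M <= I, the Bernstein weights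
    'C(n, k) <A^k (I - A)^(n - k) h, h> >= 0 at the points M k / n have moments tending
    to those of N. Their distribution functions are made to converge along one
    ultrafilter, independent of h, so that the limit remains a quadratic form in h; by a
    Dynkin argument so is mu_h(S) for every Borel set S, and <G(S) h, h> is
    mu_((N - I) h)(S). *)

Require Import Defs.
From HB Require Import structures.
From mathcomp Require Import all_boot all_order all_algebra.
From mathcomp Require Import all_classical all_reals all_analysis.
From mathcomp Require Import measurable_realfun.
From mathcomp Require Import complex ring lra zify.

Set Implicit Arguments.
Unset Strict Implicit.
Unset Printing Implicit Defensive.
Import Order.TTheory GRing.Theory Num.Theory.
Import numFieldNormedType.Exports.
Local Open Scope complex_scope.
Local Open Scope classical_set_scope.
Local Open Scope ring_scope.


(** * Operators and quadratic forms on a Hilbert space *)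

Section Hilbert.
Variables (R : realType) (H : hilbertType R).
Implicit Types (x y z h g : H) (a b : R) (S : bop H).

(** Estimates then take place in the ordered field [R], where [lra] applies; [inner_rdot] recovers
    [inner] from [rdot] and multiplication by ['i]. *)
Definition rdot x y : R := complex.Re (inner x y).

Lemma innerDl x y z : inner (x + y) z = inner x z + inner y z.
Proof. exact: linearDl. Qed.
Lemma innerDr x y z : inner z (x + y) = inner z x + inner z y.
Proof. exact: linearDr. Qed.
Lemma innerZl (l : R[i]) x y : inner (l *: x) y = l * inner x y.
Proof. exact: linearZl_LR. Qed.
Lemma innerZr (l : R[i]) x y : inner x (l *: y) = Num.conj l * inner x y.
Proof. exact: linearZr_LR. Qed.
Lemma inner_conj x y : inner x y = Num.conj (inner y x).
Proof. by rewrite /inner (hermC (dot H) x y) expr0 mul1r. Qed.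
Lemma innerNl x y : inner (- x) y = - inner x y.
Proof. exact: linearNl. Qed.
Lemma innerNr x y : inner x (- y) = - inner x y.
Proof. exact: linearNr. Qed.
Lemma inner_norm x : inner x x = `|x| ^+ 2.
Proof. exact: dotE. Qed.

Lemma rdotC x y : rdot x y = rdot y x.
Proof. by rewrite /rdot inner_conj; case: (inner y x). Qed.
Lemma rdotDl x y z : rdot (x + y) z = rdot x z + rdot y z.
Proof. by rewrite /rdot innerDl; case: (inner x z); case: (inner y z). Qed.
Lemma rdotDr x y z : rdot z (x + y) = rdot z x + rdot z y.
Proof. by rewrite rdotC rdotDl !(rdotC z). Qed.
Lemma rdotNl x y : rdot (- x) y = - rdot x y.
Proof. by rewrite /rdot innerNl; case: (inner x y). Qed.
Lemma rdotNr x y : rdot x (- y) = - rdot x y.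
Proof. by rewrite rdotC rdotNl rdotC. Qed.
Lemma rdotBl x y z : rdot (x - y) z = rdot x z - rdot y z.
Proof. by rewrite rdotDl rdotNl. Qed.
Lemma rdotBr x y z : rdot z (x - y) = rdot z x - rdot z y.
Proof. by rewrite rdotDr rdotNr. Qed.
Lemma rdotZl a x y : rdot (a%:C *: x) y = a * rdot x y.
Proof.
by rewrite /rdot innerZl; case: (inner x y) => u v /=; rewrite mul0r subr0.
Qed.
Lemma rdotZr a x y : rdot x (a%:C *: y) = a * rdot x y.
Proof. by rewrite rdotC rdotZl rdotC. Qed.
Lemma rdotiE x y : rdot ('i *: x) y = - complex.Im (inner x y).
Proof.
by rewrite /rdot innerZl; case: (inner x y) => u v /=; rewrite mul0r mul1r sub0r.
Qed.
Lemma rdotil x y : rdot ('i *: x) y = - rdot x ('i *: y).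
Proof.
rewrite [in RHS]rdotC !rdotiE inner_conj; case: (inner y x) => u v /=.
by rewrite opprK.
Qed.

Lemma norm_rdot x : `|x| ^+ 2 = (rdot x x)%:C.
Proof.
rewrite /rdot -inner_norm.
have : 0 <= inner x x by rewrite inner_norm exprn_ge0.
by case: (inner x x) => u v; rewrite lecE /= => /andP[/eqP-> _].
Qed.

Lemma rdot_ge0 x : 0 <= rdot x x.
Proof. by rewrite -lecR -norm_rdot exprn_ge0. Qed.

Lemma rdot_eq0 x : rdot x x = 0 -> x = 0.
Proof.
move=> x0; apply/eqP; rewrite -normr_eq0 -sqrf_eq0 norm_rdot x0.
by rewrite eqxx.
Qed.

Lemma rdot_ext x y : (forall z, rdot x z = rdot y z) -> x = y.
Proof.
move=> xy; apply/eqP; rewrite -subr_eq0; apply/eqP/rdot_eq0.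
by rewrite rdotBl xy subrr.
Qed.

(** For [r > 0] evaluate at the vertex [- q / r]; for [r = 0] an affine function bounded below is
    constant. *)
Lemma real_discriminant (p q r : R) :
  (forall t : R, 0 <= p + t * q *+ 2 + t ^+ 2 * r) -> 0 <= r -> q ^+ 2 <= p * r.
Proof.
move=> h; rewrite le_eqVlt => /predU1P[r0|r0].
  subst r; rewrite mulr0; have [->|q0] := eqVneq q 0; first by rewrite expr0n.
  (* At this point the polynomial would take the value -1. *)
  have := h (- (p + 1) / (q *+ 2)).
  rewrite mulr0 addr0 -mulrnAr mulrVK ?unitfE ?mulrn_eq0//=; lra.
have := h (- q / r).
suff -> : p + - q / r * q *+ 2 + (- q / r) ^+ 2 * r = (p * r - q ^+ 2) / r.
  by rewrite pmulr_lge0 ?invr_gt0// subr_ge0.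
by field; rewrite gt_eqF.
Qed.

Lemma rdot_CS x y : rdot x y ^+ 2 <= rdot x x * rdot y y.
Proof.
apply: real_discriminant (rdot_ge0 _) => t.
have := rdot_ge0 (x + t%:C *: y).
rewrite !(rdotDl, rdotDr, rdotZl, rdotZr) (rdotC y x); lra.
Qed.

Lemma norm_le_rdot (K : R) x y : 0 <= K ->
  `|x| <= K%:C * `|y| <-> rdot x x <= K ^+ 2 * rdot y y.
Proof.
move=> K0; rewrite -(@ler_pXn2r _ 2)// ?nnegrE ?mulr_ge0 ?lecR//.
by rewrite exprMn !norm_rdot -rmorphXn -rmorphM/= lecR.
Qed.

Lemma norm_lt_rdot (e : R) x : 0 <= e -> (`|x| < e%:C) = (rdot x x < e ^+ 2).
Proof.
move=> e0; rewrite -(@ltr_pXn2r _ 2)// ?nnegrE ?lecR//.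
by rewrite norm_rdot -rmorphXn/= ltcR.
Qed.

(** If [v] represents [phi], then |x|^2 - 2 phi x = |x - v|^2 - |v|^2, so [v] is found by minimising
    the left side. Homogeneity is over real scalars, so that [phi] can be the real part of a complex
    functional. *)
Lemma riesz (phi : H -> R) (K : R) :
  0 <= K -> {morph phi : x y / x + y} -> (forall a x, phi (a%:C *: x) = a * phi x) ->
  (forall x, phi x ^+ 2 <= K * rdot x x) ->
  exists v, forall x, phi x = rdot v x.
Proof.
move=> K0 phiD phiZ phiK.
(* A minimising sequence of J is Cauchy, and its limit represents phi. *)
pose J x := rdot x x - phi x *+ 2.
have JK x : - K <= J x.
  rewrite /J; have := phiK x; have := rdot_ge0 x; move: (rdot x x) (phi x) => r p.
  move=> r0 prK; rewrite leNgt; apply/negP => h.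
  have : 0 < (p *+ 2 - (K + r)) * (p *+ 2 + (K + r)) by apply: mulr_gt0; lra.
  have := sqr_ge0 (K - r); lra.
have infJ : has_inf (range J).
  by split; [exists (J 0); exists 0 | exists (- K) => _ [x _ <-]; exact: JK].
set d := inf (range J).
have dJ x : d <= J x by apply: ge_inf; [case: infJ | exists x].
have /choice[v vJ] (n : nat) : exists v, J v < d + n.+1%:R^-1.
  have n0 : 0 < n.+1%:R^-1 :> R by rewrite invr_gt0.
  have [_ [x _ <-] Jx] := inf_adherent n0 infJ.
  by exists x.
(* Since J (v n + t g) >= d for all t, the discriminant bounds the defect of [v n] at every [g]. *)
have key n g : (rdot (v n) g - phi g) ^+ 2 <= n.+1%:R^-1 * rdot g g.
  apply: (@le_trans _ _ ((J (v n) - d) * rdot g g)).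
    apply: real_discriminant (rdot_ge0 _) => t.
    have := dJ (v n + t%:C *: g); rewrite /J !phiD !phiZ.
    rewrite !(rdotDl, rdotDr, rdotZl, rdotZr) (rdotC g); lra.
  by rewrite ler_wpM2r ?rdot_ge0// lerBlDl ltW.
(* For g = v n - v m, |g|^2 is a difference s - t of two defects, and (s - t)^2 <= 2 s^2 + 2 t^2. *)
have vC n m : rdot (v n - v m) (v n - v m) <= (n.+1%:R^-1 + m.+1%:R^-1) *+ 2.
  set g := v n - v m.
  have [/eqP->|g0] := boolP (rdot g g == 0); first by rewrite mulrn_wge0// addr_ge0.
  have {}g0 : 0 < rdot g g by rewrite lt_neqAle eq_sym g0 rdot_ge0.
  have gE : rdot g g = (rdot (v n) g - phi g) - (rdot (v m) g - phi g).
    by rewrite {1}/g rdotBl; lra.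
  rewrite -(ler_pM2r g0); have := key n g; have := key m g.
  move: gE; move: (rdot (v n) g - phi g) (rdot (v m) g - phi g) => s t.
  move: (rdot g g) (n.+1%:R^-1) (m.+1%:R^-1) => r a b.
  by move=> /(congr1 (fun r => r ^+ 2)) /=; have := sqr_ge0 (s + t); lra.
have /cauchy_cvg vcvg : cauchy (v @ \oo).
  apply/cauchy_ballP => e; case: e => e ie; rewrite ltcE/= => /andP[/eqP -> e0].
  have e4 : 0 < e ^+ 2 / 4%:R by rewrite divr_gt0 ?exprn_gt0.
  have [N _ Ne] := near_infty_natSinv_lt (PosNum e4).
  exists (v @` [set n | (N <= n)%N], v @` [set n | (N <= n)%N]) => /=.
    by split; exists N => // n /= Nn; exists n.
  case=> _ _ /= [[n Nn <-] [m Nm <-]]; rewrite -ball_normE /=.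
  rewrite norm_lt_rdot ?ltW//; apply: le_lt_trans (vC n m) _.
  have := Ne n Nn; have := Ne m Nm; rewrite /=.
  by move: (n.+1%:R^-1) (m.+1%:R^-1) => a b; lra.
exists (lim (v @ \oo)) => x; set w := lim _.
apply/eqP; rewrite eq_sym -subr_eq0 -sqrf_eq0 eq_le sqr_ge0 andbT.
apply/ler_addgt0Pr => e e0; rewrite add0r.
(* The error is <w - v n, x> plus the defect of [v n] at [x]; both squares will be at most r |x|^2,
   so the squared error is at most 4 r |x|^2 <= e. *)
have x1 : 0 < (rdot x x + 1) *+ 4 by have := rdot_ge0 x; lra.
have d0 : 0 < e / ((rdot x x + 1) *+ 4) by rewrite divr_gt0.
move: (divfK (lt0r_neq0 x1) e); set r := e / _ in d0 *; move=> eE.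
have d0C : 0 < (Num.sqrt r)%:C :> R[i] by rewrite ltcR sqrtr_gt0.
have [n [nr nw]] : exists n, n.+1%:R^-1 < r /\ rdot (w - v n) (w - v n) < r.
  have : \forall n \near \oo, n.+1%:R^-1 < r /\ rdot (w - v n) (w - v n) < r.
    near=> n; split; first by near: n; exact: near_infty_natSinv_lt (PosNum d0).
    rewrite -[ltRHS]sqr_sqrtr ?ltW// -norm_lt_rdot//.
    by near: n; exact: (cvgr_dist_lt (F := \oo)).
  by case=> n _ /(_ n (leqnn n)); exists n.
have := key n x; have := rdot_CS (w - v n) x; rewrite rdotBl.
move: (sqr_ge0 (rdot w x - rdot (v n) x - (rdot (v n) x - phi x))).
have := rdot_ge0 x; move: (rdot (w - v n) _) nw (n.+1%:R^-1) nr eE => p pr q qr.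
move: (rdot x x) (rdot w x) (rdot (v n) x) (phi x) => xx wx vx ph <-.
move=> xx0 h1 h2 h3.
have : p * xx <= r * xx by rewrite ler_wpM2r// ltW.
have : q * xx <= r * xx by rewrite ler_wpM2r// ltW.
lra.
Unshelve. all: by end_near. Qed.


Lemma inner_rdot x y : inner x y = rdot x y +i* - rdot ('i *: x) y.
Proof. by rewrite rdotiE opprK /rdot; case: (inner x y). Qed.

Lemma scaler_complexE (l : R[i]) x :
  l *: x = (complex.Re l)%:C *: x + (complex.Im l)%:C *: ('i *: x).
Proof. by rewrite scalerA -scalerDl [in RHS]mulrC -complexE. Qed.

Lemma bop_rdot_bounded S : exists K : R, forall x, rdot (S x) (S x) <= K ^+ 2 * rdot x x.
Proof.
have [M SM] := bop_bounded S.
exists `|M| => x; apply/norm_le_rdot => //; apply: le_trans (SM x) _.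
by rewrite ler_wpM2r// lecR ler_norm.
Qed.

(** Complex linearity amounts to real linearity and commutation with ['i]; in this form it can be
    checked with [rdot] alone. *)
Lemma bop_intro (f : H -> H) (K : R) : {morph f : x y / x + y} ->
  (forall a x, f (a%:C *: x) = a%:C *: f x) -> (forall x, f ('i *: x) = 'i *: f x) ->
  (forall x, rdot (f x) (f x) <= K ^+ 2 * rdot x x) ->
  exists S : bop H, forall x, S x = f x.
Proof.
move=> fD fZ fi fK.
have f_linear : linear f.
  move=> l x y; rewrite fD; congr (_ + _).
  by rewrite scaler_complexE fD !fZ fi -scaler_complexE.
pose L : {linear H -> H} := HB.pack f (GRing.isLinear.Build _ _ _ _ f f_linear).
have L_bounded : exists M : R, forall x, `|L x| <= M%:C * `|x|.
  by exists `|K| => x; apply/norm_le_rdot => //; rewrite real_normK ?num_real.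
by exists (Bop L_bounded).
Qed.

(** Besides the function, a [bop] carries only proofs, which are equal by proof irrelevance. *)
Lemma bop_ext S S' : (forall x, S x = S' x) -> S = S'.
Proof.
case: S S' => f fb [g gb] /= fg.
have {}fg : f = g.
  case: f g fg {fb gb} => f [[fD] [fZ]] [g [[gD] [gZ]]] /= /funext fg; move: fD fZ gD gZ.
  rewrite fg => fD fZ gD gZ.
  by rewrite (Prop_irrelevance fD gD) (Prop_irrelevance fZ gZ).
by move: fb gb; rewrite fg => fb gb; rewrite (Prop_irrelevance fb gb).
Qed.

(** Riesz represents x |-> Re <S x, y> for each y; linearity in y follows from uniqueness of the
    representing vector. *)
Lemma adjoint_exists S :
  exists S' : bop H, forall x y, inner (S x) y = inner x (S' y).
Proof.
have [K SK] := bop_rdot_bounded S.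
have bound x y : rdot (S x) y ^+ 2 <= K ^+ 2 * rdot y y * rdot x x.
  apply: le_trans (rdot_CS _ _) _.
  by rewrite mulrAC ler_wpM2r ?rdot_ge0.
have /choice[f fE] y : exists v, forall x, rdot (S x) y = rdot v x.
  apply: (@riesz (fun x => rdot (S x) y) (K ^+ 2 * rdot y y)) => [|u v|a u|u //].
  - by rewrite mulr_ge0 ?rdot_ge0 ?sqr_ge0.
  - by rewrite linearD rdotDl.
  - by rewrite linearZ rdotZl.
have [|||x|S' S'E] := @bop_intro f K.
- by move=> x y; apply: rdot_ext => z; rewrite -fE rdotDr rdotDl !fE.
- by move=> a x; apply: rdot_ext => z; rewrite -fE rdotZr rdotZl fE.
- move=> x; apply: rdot_ext => z.
  by rewrite -fE rdotC rdotil rdotC -linearZ fE rdotil.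
(* This reads |f x|^4 <= K^2 |x|^2 |f x|^2, to be divided by |f x|^2. *)
- have := bound (f x) x; rewrite fE.
  have [->|fx0] := eqVneq (rdot (f x) (f x)) 0.
    by rewrite mulr_ge0 ?rdot_ge0 ?sqr_ge0.
  by rewrite expr2 ler_pM2r// lt_neqAle eq_sym fx0 rdot_ge0.
exists S' => x y; rewrite !inner_rdot -linearZ !fE.
by rewrite !(rdotC _ (S' y)) !S'E.
Qed.

Lemma adjointP S x y : inner (S x) y = inner x (adjoint S y).
Proof.
have [S' S'P] := adjoint_exists S.
by rewrite /adjoint; case: xgetP => [S'' _ -> //|/(_ S')]; case.
Qed.

Lemma adjoint_unique S S' :
  (forall x y, inner (S x) y = inner x (S' y)) -> adjoint S = S'.
Proof.
move=> SS'; apply: bop_ext => y; apply: rdot_ext => x.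
by rewrite rdotC (rdotC _ x) /rdot -adjointP SS'.
Qed.

Lemma adjointK S : adjoint (adjoint S) = S.
Proof. by apply: adjoint_unique => x y; rewrite inner_conj -adjointP -inner_conj. Qed.

(* Only identities between finitely many values of q occur, so that the notion passes to
   pointwise limits. *)
Definition hermitian_quad (q : H -> R) :=
  [/\ forall x y z, q (x + y + z) - q (x + y - z) =
        (q (x + z) - q (x - z)) + (q (y + z) - q (y - z)),
      forall a x z, q (a%:C *: x + z) - q (a%:C *: x - z) = a * (q (x + z) - q (x - z)),
      forall a x, q (a%:C *: x) = a ^+ 2 * q x
    & forall x, q ('i *: x) = q x].

(** Polarisation turns [q] into a real bilinear form [b] invariant under ['i]; Cauchy-Schwarz bounds
    it, and Riesz gives the operator. *)
Lemma hermitian_quad_bop (q : H -> R) (K : R) : hermitian_quad q ->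
  (forall x, 0 <= q x <= K * rdot x x) ->
  exists S : bop H, forall x, inner (S x) x = (q x)%:C.
Proof.
move=> [qD qZ q2 qi] q_bnd.
have q_ge0 x : 0 <= q x by case/andP: (q_bnd x).
have qK x : q x <= K * rdot x x by case/andP: (q_bnd x).
pose b x y := (q (x + y) - q (x - y)) / 4%:R.
have qN x : q (- x) = q x.
  by have := q2 (-1) x; rewrite sqrrN expr1n mul1r rmorphN1 scaleN1r.
have bC x y : b x y = b y x by rewrite /b (addrC x y) -(qN (y - x)) opprB.
have bDl x y z : b (x + y) z = b x z + b y z by rewrite /b qD mulrDl.
have bZl a x y : b (a%:C *: x) y = a * b x y by rewrite /b qZ mulrA.
have bDr x y z : b x (y + z) = b x y + b x z by rewrite !(bC x) bDl.
have bZr a x y : b x (a%:C *: y) = a * b x y by rewrite !(bC x) bZl.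
have bNl x y : b (- x) y = - b x y by rewrite -scaleN1r -(rmorphN1 (real_complex R)) bZl mulN1r.
have bq x : b x x = q x.
  rewrite /b subrr -mulr2n -scaler_nat -(rmorph_nat (real_complex R)) q2.
  have -> : q 0 = 0 by have := q2 0 0; rewrite scaler0 expr0n mul0r.
  by field.
have bi x y : b ('i *: x) ('i *: y) = b x y.
  by rewrite /b -scalerDr -scalerBr !qi.
have bil x y : b ('i *: x) y = - b x ('i *: y).
  by rewrite -bi scalerA -expr2 sqr_i scaleN1r bNl.
have b_CS x y : b x y ^+ 2 <= q x * q y.
  apply: real_discriminant => // t; have := q_ge0 (x + t%:C *: y).
  by rewrite -!bq !(bDl, bDr, bZl, bZr) (bC y x); lra.
have bound x y : b x y ^+ 2 <= (q x * K) * rdot y y.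
  by apply: le_trans (b_CS x y) _; rewrite -mulrA ler_wpM2l.
(* [K] may be negative if H is trivial, so the sign is established for the product. *)
have K_ge0 x : 0 <= q x * K.
  have [r0|r0] := eqVneq (rdot x x) 0.
    have := qK x; rewrite r0 mulr0 => q0.
    by rewrite (le_anti (y := 0) (x := q x)) ?q0 ?q_ge0// mul0r.
  rewrite mulr_ge0// -(pmulr_lge0 _ (x := rdot x x)); last by rewrite lt_neqAle eq_sym r0 rdot_ge0.
  exact: le_trans (q_ge0 x) (qK x).
have /choice[f fE] x : exists v, forall y, b x y = rdot v y.
  exact: (@riesz (b x) (q x * K)).
have [|||x|S SE] := @bop_intro f K.
- by move=> x y; apply: rdot_ext => z; rewrite -fE rdotDl -!fE.
- by move=> a x; apply: rdot_ext => z; rewrite -fE rdotZl -fE.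
- by move=> x; apply: rdot_ext => z; rewrite -fE bil rdotil fE.
- have := b_CS x (f x); rewrite fE.
  have [->|fx0] := eqVneq (rdot (f x) (f x)) 0.
    by rewrite mulr_ge0 ?rdot_ge0 ?sqr_ge0.
  have {}fx0 : 0 < rdot (f x) (f x) by rewrite lt_neqAle eq_sym fx0 rdot_ge0.
  move=> h; rewrite -(ler_pM2r fx0) -expr2; apply: le_trans h _.
  have -> : K ^+ 2 * rdot x x * rdot (f x) (f x) =
    (K * rdot x x) * (K * rdot (f x) (f x)) by ring.
  exact: ler_pM.
exists S => x; rewrite inner_rdot SE -fE bq rdotil -fE bC bil bC.
(* The form of [S] is real, because b (ix) x = - b x (ix) = - b (ix) x. *)
have -> : b ('i *: x) x = 0; last by rewrite !oppr0.
by have := bil x x; rewrite (bC x); lra.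
Qed.

(** Complex polarisation: for y = f x, the vectors x + y and x + iy give <f y, x> = - <y, y> and <f
    y, x> = <y, y>. *)
Lemma inner_quad_eq0 (f : H -> H) : {morph f : x y / x + y} ->
  (forall x, f ('i *: x) = 'i *: f x) -> (forall x, inner (f x) x = 0) ->
  forall x, f x = 0.
Proof.
move=> fD fi f0 x; apply: rdot_eq0; rewrite /rdot; set y := f x.
have := f0 (x + y); rewrite fD innerDl !innerDr !f0 add0r addr0 => h1.
have := f0 (x + 'i *: y); rewrite fD innerDl !innerDr !f0 add0r addr0 fi => h2.
move: h1 h2; rewrite innerZl innerZr -/y.
case: (inner y y) (inner (f y) x) => [a b] [c d] /=.
move=> /eqP; rewrite eq_complex/= => /andP[/eqP h1 _].
by move=> /eqP; rewrite eq_complex/= => /andP[_ /eqP h2]; lra.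
Qed.

End Hilbert.

(** * Closure properties of hermitian quadratic forms *)

Section HermitianQuad.
Variables (R : realType) (H : hilbertType R).
Implicit Types (q : H -> R) (x y h : H).

Lemma hermitian_quad0 : hermitian_quad (fun=> 0 : R) (H := H).
Proof. by split => *; rewrite ?subrr ?addr0 ?mulr0. Qed.

Lemma hermitian_quadD q q' : hermitian_quad q -> hermitian_quad q' ->
  hermitian_quad (fun h => q h + q' h).
Proof.
move=> [a1 a2 a3 a4] [b1 b2 b3 b4]; split.
- by move=> x y z; have := a1 x y z; have := b1 x y z; lra.
- by move=> a x z; have := a2 a x z; have := b2 a x z; lra.
- by move=> a x; rewrite a3 b3 mulrDr.
- by move=> x; rewrite a4 b4.
Qed.

Lemma hermitian_quadZ (c : R) q : hermitian_quad q -> hermitian_quad (fun h => c * q h).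
Proof.
move=> [a1 a2 a3 a4]; split.
- by move=> x y z; rewrite -!mulrBr a1 mulrDr.
- by move=> a x z; rewrite -!mulrBr a2 mulrCA.
- by move=> a x; rewrite a3 mulrCA.
- by move=> x; rewrite a4.
Qed.

Lemma hermitian_quadB q q' : hermitian_quad q -> hermitian_quad q' ->
  hermitian_quad (fun h => q h - q' h).
Proof.
move=> qq /(hermitian_quadZ (-1)) /(hermitian_quadD qq).
by under eq_fun do rewrite mulN1r.
Qed.

Lemma hermitian_quad_sum n (P : pred 'I_n) (q : 'I_n -> H -> R) :
  (forall i, hermitian_quad (q i)) -> hermitian_quad (fun h => \sum_(i < n | P i) q i h).
Proof.
move=> qq; elim: (index_enum _) => [|i r IH].
  by under eq_fun do rewrite big_nil; exact: hermitian_quad0.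
under eq_fun do rewrite big_cons.
by case: (P i) => //; exact: hermitian_quadD.
Qed.

(** The filter is arbitrary because limits are taken both along an ultrafilter and along [\oo]. *)
Lemma hermitian_quad_lim (I : Type) (F : set_system I) (q_ : I -> H -> R) q :
  ProperFilter F -> (forall i, hermitian_quad (q_ i)) ->
  (forall h, q_ i h @[i --> F] --> q h) -> hermitian_quad q.
Proof.
move=> FF qq cq.
have eq_lim (u v : I -> R) (a b : R) :
    u =1 v -> u @ F --> a -> v @ F --> b -> a = b.
  by move=> /funext -> ua vb; exact: cvg_unique ua vb.
split.
- move=> x y z; apply: eq_lim (cvgB (cq _) (cq _))
    (cvgD (cvgB (cq _) (cq _)) (cvgB (cq _) (cq _))) => i.
  by case: (qq i) => h _ _ _; exact: h.
- move=> a x z; apply: eq_lim (cvgB (cq _) (cq _)) (cvgMl_tmp (cvgB (cq _) (cq _))) => i.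
  by case: (qq i) => _ h _ _; exact: h.
- move=> a x; apply: eq_lim (cq _) (cvgMl_tmp (cq _)) => i.
  by case: (qq i) => _ _ h _; exact: h.
- move=> x; apply: eq_lim (cq _) (cq _) => i.
  by case: (qq i) => _ _ _ h; exact: h.
Qed.

(** A predicate on bare functions: composites, differences and iterates can be used without
    packaging them as bounded operators. *)
Definition clinear (L : H -> H) :=
  [/\ {morph L : x y / x + y}, forall (a : R) x, L (a%:C *: x) = a%:C *: L x
    & forall x, L ('i *: x) = 'i *: L x].

Lemma clinearN (L : H -> H) : clinear L -> {morph L : x / - x}.
Proof.
by move=> [_ LZ _] x; rewrite -scaleN1r -(rmorphN1 (real_complex R)) LZ rmorphN1 scaleN1r.
Qed.

Lemma clinear_comp (L L' : H -> H) : clinear L -> clinear L' -> clinear (L \o L').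
Proof.
move=> [a1 a2 a3] [b1 b2 b3]; split=> [x y|a x|x] /=.
- by rewrite b1 a1.
- by rewrite b2 a2.
- by rewrite b3 a3.
Qed.

Lemma clinear_id : clinear idfun.
Proof. by []. Qed.

Lemma clinearB (L L' : H -> H) : clinear L -> clinear L' -> clinear (fun x => L x - L' x).
Proof.
move=> [a1 a2 a3] [b1 b2 b3]; split=> [x y|a x|x].
- by rewrite a1 b1 opprD addrACA.
- by rewrite a2 b2 scalerBr.
- by rewrite a3 b3 scalerBr.
Qed.

Lemma clinear_iter (L : H -> H) n : clinear L -> clinear (iter n L).
Proof. by move=> cL; elim: n => // n IH; exact: (clinear_comp cL IH). Qed.

Lemma clinear_bop (S : bop H) : clinear S.
Proof. by split=> [x y|a x|x]; rewrite ?linearD ?linearZ. Qed.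

Lemma hermitian_quad_comp q (L : H -> H) : clinear L -> hermitian_quad q ->
  hermitian_quad (q \o L).
Proof.
move=> cL; have LN := clinearN cL; case: cL => [LD LZ Li] [a1 a2 a3 a4].
split=> [x y z|a x z|a x|x] /=.
- by rewrite !(LD, LN).
- by rewrite !(LD, LN, LZ).
- by rewrite LZ.
- by rewrite Li.
Qed.

Lemma hermitian_quad_rdot (L : H -> H) : clinear L -> hermitian_quad (fun h => rdot (L h) h).
Proof.
move=> cL; have LN := clinearN cL; case: cL => [LD LZ Li]; split.
- by move=> x y z; rewrite !(LD, LN, rdotDl, rdotDr, rdotNl, rdotNr); lra.
- by move=> a x z; rewrite !(LD, LN, LZ, rdotDl, rdotDr, rdotNl, rdotNr, rdotZl, rdotZr); lra.
- by move=> a x; rewrite LZ rdotZl rdotZr mulrA.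
- by move=> x; rewrite Li rdotil scalerA -expr2 sqr_i scaleN1r rdotNr opprK.
Qed.

End HermitianQuad.

(** * Algebra of bounded operators and uniqueness from quadratic forms *)

Section BopAlgebra.
Variables (R : realType) (H : hilbertType R).
Implicit Types (S : bop H) (x y h : H).

Lemma bop_lincomb S S' (a b : R) :
  exists S'' : bop H, forall x, S'' x = a%:C *: S x + b%:C *: S' x.
Proof.
have [K SK] := bop_rdot_bounded S; have [K' SK'] := bop_rdot_bounded S'.
(* From |u + v|^2 <= 2 |u|^2 + 2 |v|^2. *)
pose c := (a ^+ 2 * K ^+ 2 + b ^+ 2 * K' ^+ 2) *+ 2.
have c0 : 0 <= c by rewrite mulrn_wge0// addr_ge0// mulr_ge0// sqr_ge0.
have [Sd Sz Si] := clinear_bop S; have [Sd' Sz' Si'] := clinear_bop S'.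
apply: (@bop_intro _ _ _ (Num.sqrt c)) => [x y|r x|x|x].
- by rewrite Sd Sd' !scalerDr addrACA.
- by rewrite Sz Sz' scalerDr !scalerA !(mulrC r%:C).
- by rewrite Si Si' scalerDr !scalerA !(mulrC 'i).
- rewrite sqr_sqrtr//.
  have h1 : a ^+ 2 * rdot (S x) (S x) <= a ^+ 2 * (K ^+ 2 * rdot x x).
    by rewrite ler_wpM2l ?sqr_ge0.
  have h2 : b ^+ 2 * rdot (S' x) (S' x) <= b ^+ 2 * (K' ^+ 2 * rdot x x).
    by rewrite ler_wpM2l ?sqr_ge0.
  have := rdot_ge0 (a%:C *: S x - b%:C *: S' x).
  rewrite /c !(rdotDl, rdotDr, rdotNl, rdotNr, rdotZl, rdotZr) (rdotC (S' x) (S x)).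
  by lra.
Qed.

Lemma bop_comp S S' : exists S'' : bop H, forall x, S'' x = S (S' x).
Proof.
have [K SK] := bop_rdot_bounded S; have [K' SK'] := bop_rdot_bounded S'.
apply: (@bop_intro _ _ _ (K * K')) => [x y|r x|x|x].
- by rewrite !linearD.
- by rewrite !linearZ.
- by rewrite !linearZ.
- apply: le_trans (SK (S' x)) _.
  by rewrite exprMn -[leRHS]mulrA; apply: ler_wpM2l; rewrite ?sqr_ge0.
Qed.

Lemma bop_id : exists S : bop H, forall x, S x = x.
Proof. by apply: (@bop_intro _ _ idfun 1) => // x; rewrite expr1n mul1r. Qed.

Lemma bop_iter S n : exists S' : bop H, forall x, S' x = iter n S x.
Proof.
elim: n => [|n [S' S'E]]; first exact: bop_id.
by have [S'' S''E] := bop_comp S S'; exists S'' => x; rewrite S''E S'E.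
Qed.

Lemma bop_quad_inj S S' : (forall h, inner (S h) h = inner (S' h) h) -> S = S'.
Proof.
move=> SS'; apply: bop_ext => x; apply/eqP; rewrite -subr_eq0; apply/eqP.
have [dD _ di] := clinearB (clinear_bop S) (clinear_bop S').
move: x; apply: (@inner_quad_eq0 _ _ (fun x => S x - S' x)) => // x.
by rewrite innerDl innerNl SS' subrr.
Qed.

Lemma quad_real_selfadjoint S (q : H -> R) :
  (forall h, inner (S h) h = (q h)%:C) -> selfadjoint S.
Proof.
move=> Sq; apply: bop_quad_inj => h.
by rewrite inner_conj -adjointP Sq; apply/eqP; rewrite eq_complex/= oppr0 !eqxx.
Qed.

Lemma selfadjoint_quad (f : H -> H) : (forall x y, inner (f x) y = inner x (f y)) ->
  forall h, inner (f h) h = (rdot (f h) h)%:C.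
Proof.
move=> fs h; have := inner_conj (f h) h; rewrite -fs /rdot.
case: (inner (f h) h) => a b /eqP; rewrite eq_complex/= => /andP[_ /eqP b0].
by have -> : b = 0 by lra.
Qed.

End BopAlgebra.

(** * The Hausdorff moment problem *)

Section Moments.
Variable R : realType.
Implicit Types (D : nat -> nat -> R) (M t x : R).

(* Satisfied by D k l = L(X^k (1 - X)^l) for every linear functional L on polynomials. *)
Definition pascal D := forall k l, D k l = D k.+1 l + D k l.+1.

Lemma ffact_le_expn k j : (k ^_ j <= k ^ j)%N.
Proof. by elim: j => // j IH; rewrite ffactnSr expnSr leq_mul ?leq_subr. Qed.

(** Divided by n^(j+1), this says (k/n)^j <= k^_j / n^j + j^2 / n: at grid points, powers may be
    replaced by falling factorials, whose Bernstein sums are explicit. *)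
Lemma expn_le_ffact n k j : (k <= n)%N -> (n * k ^ j <= n * k ^_ j + j ^ 2 * n ^ j)%N.
Proof.
move=> kn; elim: j => [|j IH]; first by rewrite !muln1 leq_addr.
have kN : (k ^_ j <= n ^ j)%N.
  by apply: leq_trans (ffact_le_expn k j) _; case: j {IH} => // j; rewrite leq_exp2r.
rewrite ffactnSr !expnS; move: (k ^ j)%N (k ^_ j)%N (n ^ j)%N kN IH => E P N PN IH.
have h1 : (P * k <= P * (k - j) + P * j)%N by rewrite -mulnDr leq_mul2l; lia.
have h2 : (P * j <= N * j)%N by rewrite leq_mul2r PN orbT.
have h3 : (k * (n * E) <= k * (n * P + j ^ 2 * N))%N by rewrite leq_mul2l IH orbT.
have h4 : (k * (j ^ 2 * N) <= n * (j ^ 2 * N))%N by rewrite leq_mul2r kn orbT.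
have h5 : (n * (P * k) <= n * (P * (k - j) + N * j))%N by rewrite leq_mul2l; lia.
nia.
Qed.

(** The binomial expansion of (X + (1 - X))^n = 1, multiplied by X^a (1 - X)^b. *)
Lemma pascal_sum D n a b : pascal D ->
  \sum_(k < n.+1) 'C(n, k)%:R * D (k + a)%N (n - k + b)%N = D a b.
Proof.
move=> pD; elim: n a b => [|n IH] a b; first by rewrite big_ord1 bin0 mul1r.
rewrite pD -(IH a.+1 b) -(IH a b.+1) addrC.
rewrite [X in _ = X + _]big_ord_recl [in LHS]big_ord_recl -addrA; congr (_ + _).
  by rewrite !bin0 !subn0 addSnnS.
under eq_bigr => k _ do rewrite binS natrD mulrDl.
rewrite big_split/=; congr (_ + _); last first.
  by apply: eq_bigr => k _; rewrite /bump/= add1n addSnnS subSS.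
rewrite big_ord_recr/= bin_small// mul0r addr0; apply: eq_bigr => k _.
rewrite /bump/= !add1n subSS; congr (_ * D _ _).
by have := ltn_ord k; lia.
Qed.

(** Factorial moments of the binomial law: k^_j C(n, k) = n^_j C(n - j, k - j), one factor per
    induction step, and then [pascal_sum]. *)
Lemma pascal_ffact_sum D n j a b : pascal D ->
  \sum_(k < n.+1) (k ^_ j)%:R * ('C(n, k)%:R * D (k + a)%N (n - k + b)%N) =
  (n ^_ j)%:R * D (j + a)%N b.
Proof.
move=> pD; elim: j n a => [n a|j IH [|n] a].
- by rewrite mul1r -(pascal_sum n a b pD); apply: eq_bigr => k _; rewrite mul1r.
- by rewrite big_ord1 !ffact0n !mul0r.
rewrite big_ord_recl ffact0n mul0r add0r ffactSS natrM -mulrA addSnnS -IH mulr_sumr.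
apply: eq_bigr => k _; rewrite lift0 ffactSS subSS addSnnS.
have /(congr1 (fun m => m%:R : R)) := mul_bin_diag n.+1 k; rewrite !natrM/= => h.
by rewrite [RHS]mulrCA [X in _ = _ * X]mulrA h -!mulrA [LHS]mulrCA.
Qed.

(** If [D] comes from a measure on [0, 1], this is the integral of the k-th Bernstein polynomial of
    degree n; it serves as the mass at k / n. *)
Definition bernstein_weight D n k : R := 'C(n, k)%:R * D k (n - k)%N.

Lemma bernstein_weight_sum D n : pascal D ->
  \sum_(k < n.+1) bernstein_weight D n k = D 0%N 0%N.
Proof.
move=> pD; rewrite -(pascal_sum n 0 0 pD); apply: eq_bigr => k _.
by rewrite /bernstein_weight !addn0.
Qed.

Lemma bernstein_weight_ge0 D n k : (forall k l, 0 <= D k l) -> 0 <= bernstein_weight D n k.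
Proof. by move=> D0; rewrite mulr_ge0. Qed.

(** The factorial moment is exactly N^_j / N^j times D j 0, with N = n + 1. Both this factor and the
    passage from powers to falling factorials cost at most j^2 / N, with opposite signs. *)
Lemma bernstein_moment D n j : pascal D -> (forall k l, 0 <= D k l) ->
  `|\sum_(k < n.+2) bernstein_weight D n.+1 k * (k%:R / n.+1%:R) ^+ j - D j 0%N|
    <= (j ^ 2)%:R * D 0%N 0%N / n.+1%:R.
Proof.
move=> pD D0; set N := n.+1; set W := D 0%N 0%N.
have N0 : 0 < N%:R :> R by rewrite ltr0n.
have NX0 : 0 < N%:R ^+ j :> R by rewrite exprn_gt0.
have ge_ff (k : 'I_N.+1) : (k ^_ j)%:R / N%:R ^+ j <= (k%:R / N%:R) ^+ j :> R.
  by rewrite expr_div_n ler_pM2r ?invr_gt0// -natrX ler_nat ffact_le_expn.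
have le_ff (k : nat) : (k <= N)%N ->
    (k%:R / N%:R) ^+ j <= (k ^_ j)%:R / N%:R ^+ j + (j ^ 2)%:R / N%:R :> R.
  move=> /(expn_le_ffact j); rewrite -(ler_nat R) natrD !natrM !natrX expr_div_n => h.
  have -> : (k ^_ j)%:R / N%:R ^+ j + j%:R ^+ 2 / N%:R =
    (N%:R * (k ^_ j)%:R + j%:R ^+ 2 * N%:R ^+ j) / (N%:R * N%:R ^+ j) :> R.
    by field; rewrite ?gt_eqF.
  have -> : k%:R ^+ j / N%:R ^+ j = (N%:R * k%:R ^+ j) / (N%:R * N%:R ^+ j) :> R.
    by field; rewrite ?gt_eqF.
  by rewrite ler_pM2r// invr_gt0 mulr_gt0.
have Dj : D j 0%N <= W.
  elim: j {ge_ff le_ff NX0} => // j IH; apply: le_trans IH.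
  by rewrite (pD j) lerDl.
have ffE : \sum_(k < N.+1) bernstein_weight D N k * ((k ^_ j)%:R / N%:R ^+ j) =
    (N ^_ j)%:R / N%:R ^+ j * D j 0%N.
  rewrite mulrAC -[X in D X]addn0 -pascal_ffact_sum// mulr_suml; apply: eq_bigr => k _.
  by rewrite !addn0 -/(bernstein_weight D N k) [LHS]mulrCA mulrA.
have lo : (N ^_ j)%:R / N%:R ^+ j * D j 0%N <=
    \sum_(k < N.+1) bernstein_weight D N k * (k%:R / N%:R) ^+ j.
  by rewrite -ffE ler_sum// => k _; rewrite ler_wpM2l ?bernstein_weight_ge0.
have hi : \sum_(k < N.+1) bernstein_weight D N k * (k%:R / N%:R) ^+ j <=
    (N ^_ j)%:R / N%:R ^+ j * D j 0%N + (j ^ 2)%:R / N%:R * W.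
  rewrite -ffE /W -(bernstein_weight_sum N pD) mulr_sumr -big_split/= ler_sum// => k _.
  rewrite [X in _ + X]mulrC -mulrDr ler_wpM2l ?bernstein_weight_ge0// le_ff//.
  by rewrite -ltnS.
have r1 : (N ^_ j)%:R / N%:R ^+ j <= 1 :> R.
  by rewrite ler_pdivrMr// mul1r -natrX ler_nat ffact_le_expn.
have r2 : 1 <= (N ^_ j)%:R / N%:R ^+ j + (j ^ 2)%:R / N%:R :> R.
  by have := le_ff N (leqnn _); rewrite divff ?gt_eqF// expr1n.
move: lo hi; set s := \sum_(k < _) _ => lo hi.
have e0 : 0 <= (j ^ 2)%:R / N%:R :> R by rewrite divr_ge0.
rewrite [X in _ <= X]mulrAC; have d0 := D0 j 0%N.
move: (_ / N%:R) (_ / _ ^+ j) e0 r1 r2 lo hi => e r e0 r1 r2 lo hi.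
have : 0 <= (r + e - 1) * D j 0%N by rewrite mulr_ge0// subr_ge0.
have : 0 <= (1 - r) * D j 0%N by rewrite mulr_ge0// subr_ge0.
have : 0 <= e * (W - D j 0%N) by rewrite mulr_ge0// subr_ge0.
by rewrite ler_norml => *; apply/andP; split; lra.
Qed.

(** Distribution function of the Bernstein masses, placed on [0, M]; the degree is n + 1, so that
    the mesh M / (n + 1) makes sense for every n. *)
Definition bernstein_cdf M D n t :=
  \sum_(k < n.+2 | M * (k%:R / n.+1%:R) <= t) bernstein_weight D n.+1 k.

(** The Lipschitz constant j M^(j-1) of x^j on [0, M], multiplied by M to avoid the exponent j -
    1. *)
Lemma expr_increment M j x y : 0 <= x -> x <= y -> y <= M ->
  M * (y ^+ j - x ^+ j) <= j%:R * M ^+ j * (y - x).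
Proof.
move=> x0 xy yM; elim: j => [|j IH]; first by rewrite !expr0 subrr mulr0 !mul0r.
have y0 := le_trans x0 xy; have M0 := le_trans y0 yM.
have -> : M * (y ^+ j.+1 - x ^+ j.+1) = y * (M * (y ^+ j - x ^+ j)) + M * x ^+ j * (y - x).
  by rewrite !exprS; ring.
have -> : j.+1%:R * M ^+ j.+1 * (y - x) =
    M * (j%:R * M ^+ j * (y - x)) + M * M ^+ j * (y - x) by rewrite exprS -natr1; ring.
have yx : 0 <= y - x by rewrite subr_ge0.
apply: lerD.
  apply: (@le_trans _ _ (y * (j%:R * M ^+ j * (y - x)))); first exact: ler_wpM2l.
  by rewrite ler_wpM2r// !mulr_ge0// exprn_ge0.
by rewrite ler_wpM2r// ler_wpM2l// lerXn2r ?nnegrE// (le_trans xy).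
Qed.

Lemma expr_grid_increment M j (e : R) : 0 < M -> 0 < e -> exists m : nat,
  forall i, (i < m.+1)%N ->
    (M * (i.+1%:R / m.+1%:R)) ^+ j - (M * (i%:R / m.+1%:R)) ^+ j <= e.
Proof.
move=> M0 e0.
set c := j%:R * M ^+ j.
have c0 : 0 <= c by rewrite mulr_ge0// exprn_ge0// ltW.
(* [c] vanishes for j = 0, hence the [+ 1]. *)
have ec0 : 0 < e / (c + 1) by rewrite divr_gt0// ltr_wpDl.
have [m _ /(_ m (leqnn m)) /= me] := near_infty_natSinv_lt (PosNum ec0).
exists m => i im; rewrite -(ler_pM2l M0).
have m0 : 0 < m.+1%:R :> R by rewrite ltr0n.
apply: le_trans (expr_increment _ _ _ _) _.
- by rewrite mulr_ge0 ?divr_ge0// ltW.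
- by rewrite ler_pM2l// ler_pM2r ?invr_gt0// ler_nat.
- by rewrite -[leRHS]mulr1 ler_pM2l// ler_pdivrMr// mul1r ler_nat.
rewrite -/c -mulrBr -mulrBl -natr1 addrAC subrr add0r mul1r mulrCA ler_pM2l//.
have : m.+1%:R^-1 * (c + 1) < e by rewrite -ltr_pdivlMr// ltr_wpDl.
have : 0 <= m.+1%:R^-1 :> R by rewrite invr_ge0 ltW.
by move: (m.+1%:R^-1) => a; nra.
Qed.

(** The middle term telescopes to (s k)^j for the least k with x <= s k. It is written with
    indicators of x <= s i because these integrate to values of the distribution function. *)
Lemma expr_step_approx (s : nat -> R) m j (e x : R) : s 0%N = 0 ->
  0 <= e -> {homo s : i k / (i <= k)%N >-> i <= k} ->
  (forall i, (i < m)%N -> s i.+1 ^+ j - s i ^+ j <= e) ->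
  0 <= x <= s m ->
  x ^+ j <= s m ^+ j - \sum_(i < m) (s i.+1 ^+ j - s i ^+ j) * (x <= s i)%R%:R <= x ^+ j + e.
Proof.
move=> s0 e0 s_homo; elim: m => [|m IH] se /andP[x0 xs].
  have -> : x = 0 by apply: le_anti; rewrite x0 -s0 xs.
  by rewrite big_ord0 subr0 s0 lexx lerDl.
rewrite big_ord_recr/=; have [xm|mx] := leP x (s m).
  have := IH (fun i im => se i (ltnW im)); rewrite x0 xm => /(_ isT).
  by move: (\sum_(i < m) _) => S; rewrite mulr1; lra.
rewrite mulr0 addr0 big1 ?subr0; last first.
  by move=> i _; rewrite leNgt (le_lt_trans _ mx) ?mulr0// s_homo// ltnW.
have sm0 : 0 <= s m by rewrite -s0 s_homo.
rewrite lerXn2r ?nnegrE ?(le_trans x0)//=.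
have := se m (ltnSn m); rewrite lerBlDl => /le_trans; apply.
by rewrite lerD2r lerXn2r ?nnegrE// ltW.
Qed.


Definition grid M m i : R := M * (i%:R / m.+1%:R).

Lemma grid0 M m : grid M m 0 = 0.
Proof. by rewrite /grid mul0r mulr0. Qed.

Lemma grid_max M m : grid M m m.+1 = M.
Proof. by rewrite /grid divff ?mulr1// pnatr_eq0. Qed.

Lemma grid_homo M m : 0 <= M -> {homo grid M m : i k / (i <= k)%N >-> i <= k}.
Proof. by move=> M0 i k ik; rewrite ler_wpM2l// ler_wpM2r ?invr_ge0// ler_nat. Qed.

Lemma bernstein_cdfE M D n t : bernstein_cdf M D n t =
  \sum_(k < n.+2) bernstein_weight D n.+1 k * (grid M n k <= t)%R%:R.
Proof.
rewrite /bernstein_cdf big_mkcond; apply: eq_bigr => k _; rewrite /grid.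
by case: ifP; rewrite ?mulr1 ?mulr0.
Qed.

(** M^j G(M) minus this sum is a Riemann-Stieltjes sum of x^j against dG on [0, M], after summation
    by parts; a jump of G at 0 is included. *)
Definition abel_sum M m j (G : R -> R) : R :=
  \sum_(i < m.+1) (grid M m i.+1 ^+ j - grid M m i ^+ j) * G (grid M m i).

(** Sums the step approximation of x^j against the weights. The bound does not depend on [n], which
    can therefore go to its limit with [m] fixed. *)
Lemma bernstein_cdf_approx M D n m j (e : R) : 0 <= M -> 0 <= e ->
  pascal D -> (forall k l, 0 <= D k l) ->
  (forall i, (i < m.+1)%N -> grid M m i.+1 ^+ j - grid M m i ^+ j <= e) ->
  `|\sum_(k < n.+2) bernstein_weight D n.+1 k * grid M n k ^+ j
    - (M ^+ j * D 0%N 0%N - abel_sum M m j (bernstein_cdf M D n))| <= e * D 0%N 0%N.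
Proof.
move=> M0 e0 pD D0 se.
pose step x := M ^+ j -
  \sum_(i < m.+1) (grid M m i.+1 ^+ j - grid M m i ^+ j) * (x <= grid M m i)%R%:R.
have -> : M ^+ j * D 0%N 0%N - abel_sum M m j (bernstein_cdf M D n) =
    \sum_(k < n.+2) bernstein_weight D n.+1 k * step (grid M n k).
  under [RHS]eq_bigr do rewrite mulrBr.
  rewrite sumrB -mulr_suml bernstein_weight_sum// mulrC; congr (_ - _).
  under [RHS]eq_bigr do rewrite mulr_sumr.
  rewrite exchange_big/=; apply: eq_bigr => i _.
  by rewrite bernstein_cdfE mulr_sumr; apply: eq_bigr => k _; rewrite mulrCA.
rewrite -sumrB (le_trans (ler_norm_sum _ _ _))//.
rewrite -(bernstein_weight_sum n.+1 pD) mulr_sumr ler_sum// => k _.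
have w0 : 0 <= bernstein_weight D n.+1 k by rewrite bernstein_weight_ge0.
rewrite -mulrBr normrM ger0_norm// mulrC ler_wpM2r//.
have /andP[lo hi] : grid M n k ^+ j <= step (grid M n k) <= grid M n k ^+ j + e.
  rewrite /step -[X in X ^+ j - _](grid_max M m); apply: expr_step_approx => //.
  - exact: grid0.
  - exact: grid_homo.
  - by rewrite -(grid0 M n) grid_homo//= grid_max -[leRHS](grid_max M n) grid_homo// -ltnS.
by rewrite ler_norml; lra.
Qed.

Lemma bernstein_cdf_homo M D n : (forall k l, 0 <= D k l) ->
  {homo bernstein_cdf M D n : x y / x <= y}.
Proof.
move=> D0 x y xy; rewrite !bernstein_cdfE ler_sum// => k _.
rewrite ler_wpM2l ?bernstein_weight_ge0// ler_nat.
by case: leP => // kx; rewrite (le_trans kx xy).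
Qed.

Lemma bernstein_cdf_lt0 M D n t : 0 <= M -> t < 0 -> bernstein_cdf M D n t = 0.
Proof.
move=> M0 t0; rewrite bernstein_cdfE big1// => k _.
by rewrite leNgt (lt_le_trans t0) ?mulr0// -(grid0 M n) grid_homo.
Qed.

Lemma bernstein_cdf_ge M D n t : 0 <= M -> pascal D -> M <= t ->
  bernstein_cdf M D n t = D 0%N 0%N.
Proof.
move=> M0 pD tM; rewrite bernstein_cdfE -(bernstein_weight_sum n.+1 pD).
apply: eq_bigr => k _; rewrite (le_trans _ tM) ?mulr1//.
by rewrite -[leRHS](grid_max M n) grid_homo// -ltnS.
Qed.

Lemma bernstein_cdf_bound M D n t : 0 <= M -> pascal D -> (forall k l, 0 <= D k l) ->
  0 <= bernstein_cdf M D n t <= D 0%N 0%N.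
Proof.
move=> M0 pD D0; rewrite bernstein_cdfE; apply/andP; split.
  by rewrite sumr_ge0// => k _; rewrite mulr_ge0 ?bernstein_weight_ge0.
rewrite -(bernstein_weight_sum n.+1 pD) ler_sum// => k _.
by case: (_ <= t); rewrite ?mulr1// mulr0 bernstein_weight_ge0.
Qed.

End Moments.

(** * Limit distribution functions along an ultrafilter *)

Section LimitCdf.
Variables (R : realType) (U : set_system nat).
Hypotheses (UU : UltraFilter U) (Uoo : \oo `<=` U).

(** A cluster point in the compact [a, b] is a limit along an ultrafilter; the same [U] serves all
    sequences, unlike a subsequence. *)
Lemma ultra_bounded_cvg (u : nat -> R) (a b : R) :
  (forall n, a <= u n <= b) -> cvg (u n @[n --> U]).
Proof.
move=> uab.
have [|l [_ ul]] := @segment_compact R a b (u @ U) _.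
  by apply: (@filterS _ U _ setT) => [n _|]; [rewrite /= in_itv/= uab|exact: filterT].
apply/cvg_ex; exists l => V lV.
have [//|UV] := in_ultra_setVsetC (u @^-1` V) UU.
by have [x []] := ul (~` V) V UV lV.
Qed.

Variables (M : R) (D : nat -> nat -> R).
Hypotheses (M0 : 0 < M) (pD : pascal D) (D0 : forall k l, 0 <= D k l).
Implicit Types s t x : R.

(** Takes the place of Helly's selection theorem, but need not be right-continuous. *)
Definition ultra_cdf t : R := lim (bernstein_cdf M D n t @[n --> U]).
(** The right limit, taken along a fixed sequence so as to be again a pointwise limit in which
    identities between finitely many values survive. *)
Definition limit_cdf t : R := lim (ultra_cdf (t + n.+1%:R^-1) @[n --> \oo]).

Let M0' : 0 <= M. Proof. exact: ltW. Qed.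

Lemma ultra_cdf_cvg t : bernstein_cdf M D n t @[n --> U] --> ultra_cdf t.
Proof. by apply: (@ultra_bounded_cvg _ 0 (D 0%N 0%N)) => n; apply: bernstein_cdf_bound. Qed.

Lemma ultra_cdf_homo : {homo ultra_cdf : x y / x <= y}.
Proof.
move=> x y xy; rewrite -subr_ge0.
have c : bernstein_cdf M D n y - bernstein_cdf M D n x @[n --> U] --> ultra_cdf y - ultra_cdf x.
  by apply: cvgB; exact: ultra_cdf_cvg.
apply: (cvgr_to_ge c).
by apply: nearW => n; rewrite subr_ge0 bernstein_cdf_homo.
Qed.

Lemma ultra_cdf_lt0 t : t < 0 -> ultra_cdf t = 0.
Proof.
move=> t0; apply/cvg_lim => //.
by under eq_cvg do rewrite bernstein_cdf_lt0//; exact: cvg_cst.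
Qed.

Lemma ultra_cdf_ge t : M <= t -> ultra_cdf t = D 0%N 0%N.
Proof.
move=> t0; apply/cvg_lim => //.
by under eq_cvg do rewrite bernstein_cdf_ge//; exact: cvg_cst.
Qed.

Lemma ultra_cdf_bound t : 0 <= ultra_cdf t <= D 0%N 0%N.
Proof.
apply/andP; split.
  by apply: (cvgr_to_ge (@ultra_cdf_cvg t)); apply: nearW => n;
    case/andP: (bernstein_cdf_bound n t M0' pD D0).
by apply: (cvgr_to_le (@ultra_cdf_cvg t)); apply: nearW => n;
  case/andP: (bernstein_cdf_bound n t M0' pD D0).
Qed.

(** Limit of [bernstein_cdf_approx] along [U]: the moments converge along [\oo], hence along [U],
    and the Abel sum involves finitely many points. *)
Lemma ultra_cdf_moment m j (e : R) : 0 <= e ->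
  (forall i, (i < m.+1)%N -> grid M m i.+1 ^+ j - grid M m i ^+ j <= e) ->
  `|M ^+ j * D j 0%N - (M ^+ j * D 0%N 0%N - abel_sum M m j ultra_cdf)| <= e * D 0%N 0%N.
Proof.
move=> e0 se.
have cS : \sum_(k < n.+2) bernstein_weight D n.+1 k * grid M n k ^+ j @[n --> U]
    --> M ^+ j * D j 0%N.
  suff: \sum_(k < n.+2) bernstein_weight D n.+1 k * grid M n k ^+ j @[n --> \oo]
    --> M ^+ j * D j 0%N by move=> h V /h /Uoo.
  have -> : (fun n => \sum_(k < n.+2) bernstein_weight D n.+1 k * grid M n k ^+ j) =
      (fun n => M ^+ j * \sum_(k < n.+2) bernstein_weight D n.+1 k * (k%:R / n.+1%:R) ^+ j).
    by apply/funext => n; rewrite mulr_sumr; apply: eq_bigr => k _; rewrite exprMn mulrCA.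
  apply: cvgMl_tmp; apply/cvgrPdist_le => d d0.
  pose c := (j ^ 2)%:R * D 0%N 0%N.
  have c0 : 0 <= c by rewrite mulr_ge0.
  have dc0 : 0 < d / (c + 1) by rewrite divr_gt0// ltr_wpDl.
  near=> n; rewrite distrC; apply: le_trans (bernstein_moment n j pD D0) _; rewrite -/c.
  have : n.+1%:R^-1 < d / (c + 1).
    by near: n; exact: (near_infty_natSinv_lt (PosNum dc0)).
  have : 0 <= n.+1%:R^-1 :> R by rewrite invr_ge0.
  rewrite ltr_pdivlMr ?ltr_wpDl//; move: (n.+1%:R^-1) => a; nra.
have cA : abel_sum M m j (bernstein_cdf M D n) @[n --> U] --> abel_sum M m j ultra_cdf.
  apply: cvg_big => [|i _]; first exact: add_continuous.
  by apply: cvgMl_tmp; exact: ultra_cdf_cvg.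
apply: cvgr_to_le (cvg_norm (cvgB cS (cvgB (cvg_cst (M ^+ j * D 0%N 0%N)) cA))) _.
by apply: nearW => n; apply: bernstein_cdf_approx.
Unshelve. all: by end_near. Qed.

Lemma limit_cdf_cvg t : ultra_cdf (t + n.+1%:R^-1) @[n --> \oo] --> limit_cdf t.
Proof.
apply: nonincreasing_is_cvgn => [n k nk|].
  by rewrite ultra_cdf_homo// lerD2l lef_pV2 ?posrE// ler_nat.
by exists 0 => _ [n _ <-]; case/andP: (ultra_cdf_bound (t + n.+1%:R^-1)).
Qed.

Lemma ultra_le_limit_cdf t : ultra_cdf t <= limit_cdf t.
Proof.
apply: (cvgr_to_ge (@limit_cdf_cvg t)); apply: nearW => n.
by rewrite ultra_cdf_homo// lerDl.
Qed.

(** Together with [ultra_le_limit_cdf] this interlaces the two functions, which carries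
    monotonicity, end values and moments over to [limit_cdf]. *)
Lemma limit_lt_ultra_cdf s t : s < t -> limit_cdf s <= ultra_cdf t.
Proof.
move=> st; apply: (cvgr_to_le (@limit_cdf_cvg s)).
have ts : 0 < t - s by rewrite subr_gt0.
near=> n; apply: ultra_cdf_homo; rewrite -lerBrDl ltW//.
by near: n; exact: (near_infty_natSinv_lt (PosNum ts)).
Unshelve. all: by end_near. Qed.

Lemma limit_cdf_homo : {homo limit_cdf : x y / x <= y}.
Proof.
move=> x y; rewrite le_eqVlt => /predU1P[->//|xy].
exact: le_trans (limit_lt_ultra_cdf xy) (ultra_le_limit_cdf y).
Qed.

Lemma limit_cdf_right_continuous t : limit_cdf @ at_right t --> limit_cdf t.
Proof.
apply/cvgrPdist_le => e e0.
have /cvgrPdist_le/(_ e e0)[n _ /(_ n (leqnn n)) /= ne] := @limit_cdf_cvg t.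
near=> s.
have ts : t < s by near: s; exact: nbhs_right_gt.
have sn : s < t + n.+1%:R^-1 by near: s; apply: nbhs_right_lt; rewrite ltrDl.
have h1 := limit_cdf_homo (ltW ts); have h2 := limit_lt_ultra_cdf sn.
have h3 : limit_cdf t <= ultra_cdf (t + n.+1%:R^-1) by rewrite limit_lt_ultra_cdf// ltrDl.
by rewrite ler0_norm ?subr_le0//; move: ne; rewrite ler0_norm ?subr_le0//; lra.
Unshelve. all: by end_near. Qed.

Lemma limit_cdf_lt0 t : t < 0 -> limit_cdf t = 0.
Proof.
move=> t0; apply: le_anti; apply/andP; split; last first.
  by apply: le_trans (ultra_le_limit_cdf t); case/andP: (ultra_cdf_bound t).
by rewrite -(@ultra_cdf_lt0 (t / 2%:R)) ?limit_lt_ultra_cdf//; lra.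
Qed.

Lemma limit_cdf_ge t : M <= t -> limit_cdf t = D 0%N 0%N.
Proof.
move=> Mt; apply: le_anti; apply/andP; split.
  by rewrite -(@ultra_cdf_ge (t + 1)) ?limit_lt_ultra_cdf//; lra.
by rewrite -(ultra_cdf_ge Mt) ultra_le_limit_cdf.
Qed.

(** By interlacing, the two functions differ at a grid point by at most the increment of [ultra_cdf]
    to the next one; these increments telescope, which costs a second e D 0 0. *)
Lemma limit_cdf_moment m j (e : R) : 0 <= e ->
  (forall i, (i < m.+1)%N -> grid M m i.+1 ^+ j - grid M m i ^+ j <= e) ->
  `|M ^+ j * D j 0%N - (M ^+ j * D 0%N 0%N - abel_sum M m j limit_cdf)| <= (e * D 0%N 0%N) *+ 2.
Proof.
move=> e0 se; have := ultra_cdf_moment e0 se.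
have inc i : 0 <= grid M m i.+1 ^+ j - grid M m i ^+ j.
  rewrite subr_ge0 lerXn2r ?nnegrE -?(grid0 M m) ?grid_homo//.
have lo : abel_sum M m j ultra_cdf <= abel_sum M m j limit_cdf.
  by apply: ler_sum => i _; rewrite ler_wpM2l ?ultra_le_limit_cdf.
have hi : abel_sum M m j limit_cdf - abel_sum M m j ultra_cdf <= e * D 0%N 0%N.
  rewrite -sumrB.
  apply: (@le_trans _ _ (\sum_(i < m.+1) e * (ultra_cdf (grid M m i.+1) - ultra_cdf (grid M m i)))).
    apply: ler_sum => i _; rewrite -mulrBr ler_pM// ?subr_ge0 ?ultra_le_limit_cdf//.
      exact: se.
    rewrite lerD2r limit_lt_ultra_cdf// /grid ltr_pM2l// ltr_pM2r ?invr_gt0// ltr_nat//.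
  rewrite -mulr_sumr ler_wpM2l//.
  rewrite -(big_mkord xpredT (fun i => ultra_cdf (grid M m i.+1) - ultra_cdf (grid M m i))).
  rewrite telescope_sumr//.
  by have /andP[_ h1] := ultra_cdf_bound (grid M m m.+1);
    have /andP[h2 _] := ultra_cdf_bound (grid M m 0); lra.
move: (abel_sum _ _ _ _) (abel_sum _ _ _ _) lo hi => a b lo hi.
by rewrite !ler_norml => /andP[h1 h2]; apply/andP; split; lra.
Qed.

End LimitCdf.

(** * From distribution functions to measures and moments *)

Section CdfMeasure.
Variable R : realType.
Implicit Types (M W t : R) (f : R -> R).

Lemma lebesgue_stieltjes_itvoc (F : cumulative R R) a b : a <= b ->
  lebesgue_stieltjes_measure F `]a, b]%classic = (F b - F a)%:E.
Proof.
move=> ab; rewrite /lebesgue_stieltjes_measure /measure_extension/=.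
by rewrite measurable_mu_extE/= ?wlength_itv_bnd//; exact: is_ocitv.
Qed.

(** The Lebesgue-Stieltjes measure of [f], restricted to [0, M]; the restriction makes it finite. *)
Lemma cdf_measure f M W : 0 < M -> {homo f : x y / x <= y} ->
  (forall t, f @ at_right t --> f t) -> (forall t, t < 0 -> f t = 0) ->
  (forall t, M <= t -> f t = W) ->
  exists mu : {finite_measure set R -> \bar R},
    (forall t, mu `]-oo, t]%classic = (f t)%:E) /\ mu (~` `[0, M]%classic) = 0%E.
Proof.
move=> M0 f_homo f_rc f_lt0 f_ge.
pose F : cumulative R R := HB.pack f (isCumulative.Build R _ R f f_homo f_rc).
pose ls0 := lebesgue_stieltjes_measure F.
(* lebesgue_stieltjes_measure lives on a copy of R with another measure display. *)
pose ls : {measure set R -> \bar R} := HB.pack (ls0 : set R -> \bar R)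
  (isMeasure.Build _ R R ls0 (measure0 ls0) (measure_ge0 ls0)
    (@measure_semi_sigma_additive _ _ _ ls0)).
have lsE a b : a <= b -> ls `]a, b]%classic = (f b - f a)%:E.
  exact: lebesgue_stieltjes_itvoc.
(* [f] may jump at 0, so ]-1, 0[ is exhausted by half-open intervals ending before 0, on which [f]
   vanishes. *)
have lsn n : ls `]-1, (0 - n.+1%:R^-1)]%classic = 0%E.
  have n0 : 0 < n.+1%:R^-1 :> R by rewrite invr_gt0.
  have n1 : n.+1%:R^-1 <= 1 :> R by rewrite invf_le1// ler1n.
  move: (n.+1%:R^-1) n0 n1 => a a0 a1.
  by rewrite lsE ?f_lt0 ?subrr//; lra.
have lsN : ls `]-1, 0[%classic = 0%E.
  apply/negligibleP; first exact: measurable_itv.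
  rewrite itv_bnd_open_bigcup; apply: negligible_bigcup => n.
  by apply/negligibleP; [exact: measurable_itv|exact: lsn].
(* The interval formula gives the mass of ]-1, s], which differs from [0, s] by the null set ]-1,
   0[. *)
have lsc s : 0 <= s -> ls `[0, s]%classic = (f s)%:E.
  move=> s0; have s1 : -1 <= s by lra.
  have <- : ls `]-1, s]%classic = (f s)%:E by rewrite lsE// (f_lt0 (-1)) ?subr0//; lra.
  apply: le_anti; apply/andP; split.
    by rewrite le_measure ?inE//; apply: subset_itv; rewrite // bnd_simp; lra.
  apply: (@le_trans _ _ (ls (`]-1, 0[%classic `|` `[0, s]%classic))).
    rewrite le_measure ?inE//; first exact: measurableU.
    move=> x /=; rewrite !in_itv/= => /andP[x1 ->]; rewrite x1 andbT.
    by case: ltP; [left | right].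
  by apply: le_trans (measureU2 _ _ _) _ => //; rewrite [X in (X + _ <= _)%E]lsN add0e.
have mD : measurable `[0, M]%classic := measurable_itv _.
have lsD : (ls `[0%R, M]%classic < +oo)%E by rewrite lsc ?ltry// ltW.
pose mu : {finite_measure set R -> \bar R} := mfrestr mD lsD.
have muE (A : set R) : mu A = ls (A `&` `[0, M]%classic) by [].
exists mu; split => [t|]; rewrite muE; last by rewrite setICl measure0.
have [t0|t0] := ltP t 0.
  rewrite f_lt0// (_ : _ `&` _ = set0) ?measure0//.
  by rewrite -subset0 => x [] /=; rewrite !in_itv/= => xt /andP[x0 _]; lra.
have [tM|Mt] := leP t M.
  rewrite -lsc//; congr (ls _); apply/seteqP; split => x /=; rewrite !in_itv/=.
    by move=> [-> /andP[->]].
  by move=> /andP[-> xt]; rewrite xt (le_trans xt tM).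
rewrite (f_ge t) ?ltW// -(f_ge M)// -lsc ?ltW//; congr (ls _).
apply/seteqP; split => x /=; rewrite !in_itv/=; first by case.
by move=> /andP[-> xM]; rewrite xM (le_trans xM) ?ltW.
Qed.

Section EFinIntegrable.
Variables (nu : {measure set R -> \bar R}) (E : set R) (mE : measurable E).
Implicit Types g h : R -> R.

Lemma integrable_EFinD g h : nu.-integrable E (EFin \o g) -> nu.-integrable E (EFin \o h) ->
  nu.-integrable E (EFin \o (fun x => g x + h x)).
Proof. by move=> ig ih; exact: eq_integrable (integrableD mE ig ih). Qed.

Lemma integrable_EFinZ g (c : R) : nu.-integrable E (EFin \o g) ->
  nu.-integrable E (EFin \o (fun x => c * g x)).
Proof. by move=> ig; exact: eq_integrable (integrableZl mE c ig). Qed.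

End EFinIntegrable.

Variables (mu : {finite_measure set R -> \bar R}) (f : R -> R) (M : R).
Hypotheses (M0 : 0 < M) (muf : forall t, mu `]-oo, t]%classic = (f t)%:E).
Hypothesis muC : mu (~` `[0, M]%classic) = 0%E.

Lemma measure_supportI (A : set R) : measurable A -> mu (A `&` `[0, M]) = mu A.
Proof.
move=> mA; rewrite [RHS](measureDI mu mA (measurable_itv `[0, M])).
rewrite [X in (X + _)%E](_ : _ = 0%E) ?add0e//.
apply/eqP; rewrite -measure_le0 -muC.
by apply: le_measure => [||x []//]; rewrite inE; [exact: measurableD|exact: measurableC].
Qed.

Lemma bounded_integrable (g : R -> R) (K : R) : measurable_fun [set: R] g ->
  (forall x, 0 <= x <= M -> `|g x| <= K) -> mu.-integrable `[0, M] (EFin \o g).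
Proof.
move=> mg gK; apply: measurable_bounded_integrable => //.
- by rewrite ltey_eq fin_num_measure.
- exact: measurable_funTS.
- exists K; split; first exact: num_real.
  by move=> k Kk x /=; rewrite in_itv/= => /gK /le_trans; apply; exact: ltW.
Qed.

Lemma expr_integrable j : mu.-integrable `[0, M] (EFin \o (fun x : R => x ^+ j)).
Proof.
apply: (@bounded_integrable _ (M ^+ j)); first exact: measurable_funX.
by move=> x /andP[x0 xM]; rewrite normrX ger0_norm// lerXn2r ?nnegrE// ltW.
Qed.

Lemma step_integral n (c s : nat -> R) :
  mu.-integrable `[0, M] (EFin \o (fun x => \sum_(i < n) c i * (x <= s i)%R%:R)) /\
  \int[mu]_(x in `[0, M]) (\sum_(i < n) c i * (x <= s i)%R%:R) = \sum_(i < n) c i * f (s i).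
Proof.
have ind t : (fun x : R => (x <= t)%R%:R) = \1_(`]-oo, t]) :> (R -> R).
  by apply/funext => x; rewrite indicE mem_setE in_itv.
have i1 t : mu.-integrable `[0, M] (EFin \o (fun x : R => (x <= t)%R%:R)).
  apply: (@bounded_integrable _ 1); first by rewrite ind; exact: measurable_indic.
  by move=> x _; case: (x <= t); rewrite ?normr1 ?normr0.
elim: n => [|n [i2 IH]].
  have -> : (fun x : R => \sum_(i < 0) c i * (x <= s i)%R%:R) = cst 0.
    by apply/funext => x; rewrite big_ord0.
  by rewrite big_ord0 Rintegral_cst// mul0r; split => //; exact: integrable0.
have -> : (fun x : R => \sum_(i < n.+1) c i * (x <= s i)%R%:R) =
    (fun x => \sum_(i < n) c i * (x <= s i)%R%:R + c n * (x <= s n)%R%:R).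
  by apply/funext => x; rewrite big_ord_recr.
have i3 : mu.-integrable `[0, M] (EFin \o (fun x : R => c n * (x <= s n)%R%:R)).
  exact: integrable_EFinZ.
split; first exact: integrable_EFinD.
rewrite RintegralD// IH big_ord_recr/= RintegralZl//; congr (_ + _ * _).
by rewrite ind /Rintegral integral_indic//= measure_supportI// muf.
Qed.

(** The step function of [bernstein_cdf_approx] again, now integrated against [mu]. *)
Lemma abel_sum_integral m j (e : R) : 0 <= e ->
  (forall i, (i < m.+1)%N -> grid M m i.+1 ^+ j - grid M m i ^+ j <= e) ->
  `|\int[mu]_(x in `[0, M]) (x ^+ j) - (M ^+ j * f M - abel_sum M m j f)| <= e * f M.
Proof.
move=> e0 se.
pose step x := M ^+ j -
  \sum_(i < m.+1) (grid M m i.+1 ^+ j - grid M m i ^+ j) * (x <= grid M m i)%R%:R.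
have [i1 s1] := step_integral m.+1 (fun i => grid M m i.+1 ^+ j - grid M m i ^+ j) (grid M m).
have ic (c : R) : mu.-integrable `[0, M] (EFin \o cst c).
  by apply: (@bounded_integrable _ `|c|).
have istep : mu.-integrable `[0, M] (EFin \o step) 
  by exact: eq_integrable (integrableB (measurable_itv _) (ic (M ^+ j)) i1).
have muM : mu `[0, M]%classic = (f M)%:E.
  have := @measure_supportI `]-oo, M]%classic (measurable_itv _).
  by rewrite muf setIidr// => x /=; rewrite !in_itv/= => /andP[].
have mu1 (c : R) : \int[mu]_(x in `[0, M]) c = c * f M.
  by rewrite Rintegral_cst//; congr (_ * _); exact: (congr1 fine muM).
have sE : \int[mu]_(x in `[0, M]) step x = M ^+ j * f M - abel_sum M m j f.
  by rewrite /step RintegralB//; [rewrite mu1; congr (_ - _); exact: s1|exact: ic].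
have st x : 0 <= x <= M -> x ^+ j <= step x <= x ^+ j + e.
  move=> xM; rewrite /step -[X in X ^+ j - _](grid_max M m).
  apply: expr_step_approx; rewrite ?grid_max//; first exact: grid0.
  by apply: grid_homo; exact: ltW.
have iX := expr_integrable j.
have hi : \int[mu]_(x in `[0, M]) step x <= \int[mu]_(x in `[0, M]) (x ^+ j + e).
  apply: le_Rintegral => //; first exact: (integrable_EFinD _ iX (ic e)).
  by move=> x /=; rewrite in_itv/= => /st/andP[].
have lo : \int[mu]_(x in `[0, M]) (x ^+ j) <= \int[mu]_(x in `[0, M]) step x.
  by apply: le_Rintegral => // x /=; rewrite in_itv/= => /st/andP[].
have eM : 0 <= e * f M by rewrite mulr_ge0// -lee_fin -muf measure_ge0.
move: hi; rewrite (RintegralD _ iX (ic e))// mu1 => hi.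
by rewrite -sE ler_norml; apply/andP; split; lra.
Qed.

End CdfMeasure.

(** Integral and prescribed moment are both close to the same Abel sum expression. The distribution
    function is part of the conclusion because the dependence of [mu] on [D] is later read off from
    it. *)
Theorem hausdorff_moment (R : realType) (U : set_system nat) (M : R) (D : nat -> nat -> R) :
  UltraFilter U -> \oo `<=` U -> 0 < M -> pascal D -> (forall k l, 0 <= D k l) ->
  exists mu : {finite_measure set R -> \bar R},
    [/\ forall t, mu `]-oo, t]%classic = (limit_cdf U M D t)%:E,
        mu (~` `[0, M]%classic) = 0%E
      & forall j, \int[mu]_(x in `[0, M]) (x ^+ j) = M ^+ j * D j 0%N].
Proof.
move=> UU Uoo M0 pD D0; set f := limit_cdf U M D.
have fM : f M = D 0%N 0%N by exact: limit_cdf_ge.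
have [mu [muf muC]] : exists mu : {finite_measure set R -> \bar R},
    (forall t, mu `]-oo, t]%classic = (f t)%:E) /\ mu (~` `[0, M]%classic) = 0%E.
  apply: (@cdf_measure _ f M (D 0%N 0%N)) => //.
  - exact: limit_cdf_homo.
  - exact: limit_cdf_right_continuous.
  - exact: limit_cdf_lt0.
  - exact: limit_cdf_ge.
exists mu; split => // j; apply/eqP; rewrite -subr_eq0 -normr_eq0 eq_le normr_ge0 andbT.
apply/ler_addgt0Pr => d d0; rewrite add0r.
(* The errors are e W and 2 e W with W = D 0 0; the [+ 1] covers W = 0. *)
have e0 : 0 < d / (D 0%N 0%N *+ 3 + 1) by rewrite divr_gt0// ltr_wpDl// mulrn_wge0.
have [m me] := expr_grid_increment j M0 e0.
set e := d / _ in e0 me.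
have h1 := abel_sum_integral M0 muf muC (ltW e0) me.
have h2 := limit_cdf_moment UU Uoo M0 pD D0 (ltW e0) me.
have eE : e * (D 0%N 0%N *+ 3 + 1) = d.
  by rewrite divfK// gt_eqF// ltr_wpDl// mulrn_wge0.
move: h1 h2; rewrite fM -/f !ler_norml; lra.
Qed.

(** * The spectral measures of a positive operator *)

Section SpectralMeasure.
Variables (R : realType) (H : hilbertType R) (A : H -> H).
Hypotheses (cA : clinear A) (symA : forall x y, rdot (A x) y = rdot x (A y)).
Hypotheses (posA : forall x, 0 <= rdot (A x) x) (leA : forall x, rdot (A x) x <= rdot x x).
Implicit Types (x y h : H).

Let B x : H := x - A x.
Let cB : clinear B. Proof. exact: (clinearB (clinear_id H) cA). Qed.
Let symB x y : rdot (B x) y = rdot x (B y).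
Proof. by rewrite /B rdotBl rdotBr symA. Qed.
Let AB x : A (B x) = B (A x).
Proof. by rewrite /B; case: (cA) => AD _ _; rewrite AD clinearN. Qed.
Let posB x : 0 <= rdot (B x) x.
Proof. by rewrite /B rdotBl subr_ge0. Qed.

(** The value that the integral of x^k (1 - x)^l must have against the spectral measure of [A] at
    [h]. *)
Definition bernstein_form h k l := rdot (iter k A (iter l B h)) h.
Local Notation D := bernstein_form.

Let iterAB k x : B (iter k A x) = iter k A (B x).
Proof. by elim: k => //= k <-; rewrite AB. Qed.
Let iterBA l x : A (iter l B x) = iter l B (A x).
Proof. by elim: l => //= l <-; rewrite AB. Qed.

Lemma bernstein_form_pascal h : pascal (D h).
Proof.
move=> k l; rewrite /D iterSr -rdotDl /=; congr (rdot _ _).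
by case: (clinear_iter k cA) => <- _ _; rewrite /B addrC subrK.
Qed.

(** Two factors [A], or two factors [B], can be absorbed into [h], one on each side of the inner
    product; this reduces to k, l <= 1 without operator square roots. *)
Lemma bernstein_form_ge0 h k l : 0 <= D h k l.
Proof.
have Dk x i j : D x i.+2 j = D (A x) i j by rewrite /D -iterBA -symA -iterSr.
have Dl x i j : D x i j.+2 = D (B x) i j by rewrite /D -symB iterAB -!iterSr.
elim/ltn_ind: k h l => -[|[|k]] IHk h l; last by rewrite Dk; exact: IHk.
  elim/ltn_ind: l h => -[|[|l]] IHl h; last by rewrite Dl; exact: IHl.
    exact: rdot_ge0.
  exact: posB.
elim/ltn_ind: l h => -[|[|l]] IHl h; last by rewrite Dl; exact: IHl.
  exact: posA.
(* AB = AB^2 + BA^2, because A + B = I. *)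
have -> : D h 1 1 = rdot (A (B h)) (B h) + rdot (B (A h)) (A h).
  by rewrite -AB -rdotDr /B subrK.
exact: addr_ge0.
Qed.

Lemma bernstein_form0 h : D h 0 0 = rdot h h.
Proof. by []. Qed.

Lemma bernstein_form_hermitian k l : hermitian_quad (fun h => D h k l).
Proof.
by apply: hermitian_quad_rdot; exact: (clinear_comp (clinear_iter k cA) (clinear_iter l cB)).
Qed.

Variables (U : set_system nat) (M : R).
Hypotheses (UU : UltraFilter U) (Uoo : \oo `<=` U) (M0 : 0 < M).

(** Two successive limits of hermitian forms; the first needs a filter [U] common to all [h]. *)
Lemma limit_cdf_hermitian t : hermitian_quad (fun h => limit_cdf U M (D h) t).
Proof.
have pD := bernstein_form_pascal; have D0 := bernstein_form_ge0.
have hU s : hermitian_quad (fun h => ultra_cdf U M (D h) s).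
  apply: (@hermitian_quad_lim _ _ _ U (fun n h => bernstein_cdf M (D h) n s)).
    move=> n; apply: hermitian_quad_sum => k; apply: hermitian_quadZ.
    exact: bernstein_form_hermitian.
  by move=> h; exact: ultra_cdf_cvg.
apply: (@hermitian_quad_lim _ _ _ \oo (fun n h => ultra_cdf U M (D h) (t + n.+1%:R^-1))).
  by move=> n; exact: hU.
by move=> h; exact: limit_cdf_cvg.
Qed.

Variable mu : H -> {finite_measure set R -> \bar R}.
Hypothesis muD : forall h t, mu h `]-oo, t]%classic = (limit_cdf U M (D h) t)%:E.
Hypothesis muC : forall h, mu h (~` `[0, M]%classic) = 0%E.

Lemma spectral_measure_total h : mu h setT = (rdot h h)%:E.
Proof.
rewrite -(measure_supportI (muC h))// setTI -bernstein_form0.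
rewrite -(@limit_cdf_ge _ U UU M (D h) M0 (bernstein_form_pascal h) (bernstein_form_ge0 h) M)//.
rewrite -muD -[RHS](measure_supportI (muC h))//; congr (mu h _); rewrite setIidr//.
by move=> x /=; rewrite !in_itv/= => /andP[].
Qed.

(** Dynkin induction from the rays ]t, +oo[, which are stable under intersection: complements use
    the total mass |h|^2, disjoint unions a limit of finite sums. *)
Lemma spectral_measure_hermitian S : measurable S ->
  hermitian_quad (fun h => fine (mu h S)).
Proof.
have fmu h (E : set R) : measurable E -> mu h E \is a fin_num by exact: fin_num_measure.
have hT : hermitian_quad (fun h => fine (mu h setT)).
  by under eq_fun do rewrite spectral_measure_total; exact: (hermitian_quad_rdot (clinear_id H)).
have hC (E : set R) : measurable E -> hermitian_quad (fun h => fine (mu h E)) ->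
    hermitian_quad (fun h => fine (mu h (~` E))).
  move=> mE hE; suff -> : (fun h => fine (mu h (~` E))) =
      (fun h => fine (mu h setT) - fine (mu h E)) by exact: hermitian_quadB.
  apply/funext => h; rewrite -fineB ?fmu//; congr fine.
  rewrite -(setvU E) measureU ?setICl ?addeK ?fmu//; exact: measurableC.
have GE := RGenOInfty.measurableE R.
move=> mS; apply: (@dynkin_induction _ R _
  (fun E => hermitian_quad (fun h => fine (mu h E))) GE) => //.
- move=> _ _ [a ->] [b ->]; exists (Num.max a b).
  by apply/seteqP; split => x /=; rewrite !in_itv/= !andbT gt_max => /andP.
- move=> _ [t ->]; rewrite -setCitvl; apply: hC => //.
  by under eq_fun do rewrite muD; exact: limit_cdf_hermitian.
- move=> F mF tF hF.
  apply: (@hermitian_quad_lim _ _ _ \oo (fun n h => \sum_(i < n) fine (mu h (F i)))).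
    by move=> n; exact: hermitian_quad_sum.
  move=> h; have mUF : measurable (\bigcup_k F k) by exact: bigcup_measurable.
  have /fine_cvg : (\sum_(0 <= i < n) mu h (F i))%E @[n --> \oo]
      --> (fine (mu h (\bigcup_k F k)))%:E.
    by rewrite fineK ?fmu//; exact: measure_semi_sigma_additive.
  apply: cvg_trans; apply: near_eq_cvg; apply: nearW => n /=.
  by rewrite big_mkord sum_fine// => i _; exact: fmu.
- by have : (@RGenOInfty.G R).-sigma.-measurable S by rewrite -GE.
Qed.

End SpectralMeasure.

(** * Polynomial integrals and the atom at one *)

Section AtomAtOne.
Variables (R : realType) (mu nu : {finite_measure set R -> \bar R}) (M : R).
Hypotheses (M1 : 1 <= M) (muC : mu (~` `[0, M]%classic) = 0%E).
Hypothesis nuE : forall E, measurable E -> E `<=` @Rplus R -> nu E = mu (E `\ 1).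

(** [nu] is known only on Borel subsets of [0, +oo[: there it agrees with [mu] inside [0, M] without
    1 and is null elsewhere, so the integrals differ by the atom. *)
Lemma integral_remove_atom (g : R -> R) : measurable_fun [set: R] g ->
  mu.-integrable `[0, M] (EFin \o g) ->
  nu.-integrable (@Rplus R) (EFin \o g) /\
  \int[nu]_(x in @Rplus R) g x = \int[mu]_(x in `[0, M]) g x - g 1 * fine (mu [set 1]).
Proof.
move=> mg ig; pose E := `[0, M]%classic `\ (1 : R); pose N := @Rplus R `\` E.
have mE : measurable E by exact: measurableD.
have mRp : measurable (@Rplus R) by exact: measurable_itv.
have mN : measurable N by exact: measurableD.
have sE : E `<=` @Rplus R.
  by move=> x [] /=; rewrite in_itv/= => /andP[x0 _] _; rewrite /Rplus/= in_itv/= x0.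
have NE : @Rplus R `\` N = E.
  rewrite /N setDD; exact: setIidr.
have N0 : nu N = 0%E.
  rewrite nuE//; last by move=> x [].
  apply/eqP; rewrite -measure_le0 -muC; apply: le_measure.
  - by rewrite inE; exact: measurableD.
  - by rewrite inE; exact: measurableC.
  - move=> x [] [] _ nE x1 xM; apply: nE; split => //.
have EE F : measurable F -> F `<=` E -> nu F = mu F.
  move=> mF FE; rewrite nuE//; last exact: subset_trans FE sE.
  by rewrite setDidl//; apply/disjoints_subset => x /FE [].
have iE : mu.-integrable E (EFin \o g).
  by apply: integrableS ig => // x [].
have inuE : nu.-integrable E (EFin \o g).
  case/integrableP : iE => m1 i1; apply/integrableP; split => //.
  by rewrite (eq_measure_integral mu).
have inu : nu.-integrable (@Rplus R) (EFin \o g).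
  apply/(negligible_integrable mN) => //; last by rewrite NE.
  exact/measurable_EFinP/measurable_funTS.
split => //.
have EU : `[0, M]%classic = E `|` [set 1].
  by rewrite /E setUC setDUK// => x ->; rewrite /= in_itv/= ler01.
rewrite {1}/Rintegral (negligible_integral mN)// NE (eq_measure_integral mu)//.
rewrite [in RHS]EU Rintegral_setU//; last 2 first.
- by rewrite -EU.
- by apply/disj_set2P; rewrite -subset0 => x [[_]].
rewrite (_ : \int[mu]_(x in [set 1]) g x = g 1 * fine (mu [set 1])) ?addrK//.
rewrite -Rintegral_cst//; apply: eq_Rintegral => x; rewrite inE/= => -> //.
Qed.

Lemma poly_integral (mom : nat -> R) m (c : nat -> R) :
  (forall j, \int[mu]_(x in `[0, M]) (x ^+ j) = mom j) ->
  mu.-integrable `[0, M] (EFin \o (fun x => \sum_(0 <= j < m) c j * x ^+ j)) /\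
  \int[mu]_(x in `[0, M]) (\sum_(0 <= j < m) c j * x ^+ j) = \sum_(0 <= j < m) c j * mom j.
Proof.
move=> momE; elim: m => [|m [i1 IH]].
  have -> : (fun x : R => \sum_(0 <= j < 0) c j * x ^+ j) = cst 0.
    by apply/funext => x; rewrite big_nil.
  by rewrite big_nil Rintegral_cst// mul0r; split => //; exact: integrable0.
have -> : (fun x : R => \sum_(0 <= j < m.+1) c j * x ^+ j) =
    (fun x => \sum_(0 <= j < m) c j * x ^+ j + c m * x ^+ m).
  by apply/funext => x; rewrite big_nat_recr.
have iX : mu.-integrable `[0, M] (EFin \o (fun x : R => x ^+ m)).
  by apply: expr_integrable; exact: lt_le_trans M1.
have i3 : mu.-integrable `[0, M] (EFin \o (fun x : R => c m * x ^+ m)).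
  exact: integrable_EFinZ.
split; first exact: integrable_EFinD.
by rewrite RintegralD// IH big_nat_recr//= RintegralZl// momE.
Qed.

End AtomAtOne.

(** A discrete Taylor formula. For c j = x^j it is x^n = 1 + n (x - 1) + (x - 1)^2 Q_n(x); it will
    be applied to c j = <N^j h, h>. *)
Lemma second_difference_sum (R : comRingType) (c : nat -> R) n :
  \sum_(0 <= j < n.-1) (n - j - 1)%:R * (c j.+2 - c j.+1 *+ 2 + c j) =
  c n - c 0%N - n%:R * (c 1%N - c 0%N).
Proof.
case: n => [|n]; first by rewrite big_nil mul0r; ring.
have first_sum m : \sum_(0 <= j < m) (c j.+2 - c j.+1 *+ 2 + c j) = c m.+1 - c m - (c 1%N - c 0%N).
  by elim: m => [|m IH]; [rewrite big_nil; ring|rewrite big_nat_recr//= IH; ring].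
rewrite /=; elim: n => [|n IH]; first by rewrite big_nil; ring.
(* Raising n by one adds 1 to each weight, which contributes a sum of second differences; the new
   last term has weight 0 in the old sum. *)
rewrite (eq_big_nat _ _ (F2 := fun j => (n.+1 - j - 1)%:R * (c j.+2 - c j.+1 *+ 2 + c j)
  + (c j.+2 - c j.+1 *+ 2 + c j))); last first.
  move=> j /= jn; rewrite (_ : (n.+2 - j - 1 = (n.+1 - j - 1).+1)%N); last by lia.
  by rewrite -natr1 mulrDl mul1r.
rewrite big_split/= first_sum big_nat_recr//= IH.
rewrite (_ : (n.+1 - n - 1 = 0)%N); last by lia.
by rewrite -[in RHS]natr1; ring.
Qed.

(** The sequence j (j - 1) / 2 has second difference 1. *)
Lemma Qpol_at1 (R : realType) n : Qpol n (1 : R) = n%:R * (n%:R - 1) / 2%:R.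
Proof.
have := second_difference_sum (fun j => j%:R * (j%:R - 1) / 2%:R : R) n.
rewrite mul0r mul0r subrr mulr0 mul0r !subr0 mulr0 subr0 => <-.
apply: eq_bigr => j _; rewrite expr1n; congr (_ * _).
by rewrite -(natr1 j.+1) -(natr1 j); field.
Qed.

(** * The triplet built from a positive operator *)

Section SpectralTriplet.
Variables (R : realType) (H : hilbertType R) (N : bop H) (M : R).
Hypotheses (symN : forall x y, inner (N x) y = inner x (N y)).
Hypotheses (posN : forall x, 0 <= rdot (N x) x).
Hypotheses (M1 : 1 <= M) (leN : forall x, rdot (N x) x <= M * rdot x x).
Implicit Types (x y h : H).

Let M0 : 0 < M. Proof. exact: lt_le_trans M1. Qed.
Let A x : H := (M^-1)%:C *: N x.

Let iterA j x : iter j A x = (M ^- j)%:C *: iter j N x.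
Proof.
elim: j => [|j IH] /=; first by rewrite expr0 invr1 scale1r.
by rewrite IH /A linearZ/= scalerA -rmorphM -exprVn -exprS exprVn.
Qed.

Lemma rdot_sym_bop x y : rdot (N x) y = rdot x (N y).
Proof. by rewrite /rdot symN. Qed.

Lemma spectral_measures : exists mu : H -> {finite_measure set R -> \bar R},
  [/\ forall h, mu h (~` `[0, M]%classic) = 0%E,
      forall h, mu h setT = (rdot h h)%:E,
      forall S, measurable S -> hermitian_quad (fun h => fine (mu h S))
    & forall h j, \int[mu h]_(x in `[0, M]) (x ^+ j) = rdot (iter j N h) h].
Proof.
have cA : clinear A.
  have [Nd Nz Ni] := clinear_bop N; split=> [x y|a x|x]; rewrite /A ?Nd ?Nz ?Ni.
  - by rewrite scalerDr.
  - by rewrite !scalerA mulrC.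
  - by rewrite !scalerA mulrC.
have sA x y : rdot (A x) y = rdot x (A y) by rewrite rdotZl rdotZr rdot_sym_bop.
have pA x : 0 <= rdot (A x) x by rewrite rdotZl mulr_ge0// invr_ge0 ltW.
have lA x : rdot (A x) x <= rdot x x by rewrite rdotZl ler_pdivrMl.
(* The ultrafilter is fixed before [h] is introduced. *)
have [U [UU Uoo]] := @ultraFilterLemma _ \oo _.
have /choice[mu muP] h := hausdorff_moment UU Uoo M0
  (bernstein_form_pascal cA h) (bernstein_form_ge0 cA sA pA lA h).
exists mu.
have muC h : mu h (~` `[0, M]%classic) = 0%E by case: (muP h).
have mut h t : mu h `]-oo, t]%classic = (limit_cdf U M (bernstein_form A h) t)%:E.
  by case: (muP h).
split => //.
- by move=> h; exact: (spectral_measure_total cA sA pA lA UU M0 mut muC).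
- by move=> S; exact: (spectral_measure_hermitian cA sA pA lA UU M0 mut muC).
- move=> h j; case: (muP h) => _ _ ->; rewrite /bernstein_form/= iterA rdotZl mulrA.
  by rewrite divff ?mul1r// expf_neq0// gt_eqF.
Qed.

Lemma spectral_triplet : exists (B C : bop H) (F : set R -> bop H),
  [/\ selfadjoint B, positive_op C,
      semispectral F /\ compactly_supported F,
      (forall h, F [set 1] h = 0)
    & forall n : nat, exists2 S : bop H, is_op_integral F (Qpol n) S
        & forall x, iter n N x = x + n%:R *: B x + (n ^ 2)%:R *: C x + S x].
Proof.
have [mu [muC muT muH muX]] := spectral_measures.
have [I0 I0E] := bop_id H.
have [L LE'] := bop_lincomb N I0 1 (-1).
have LE x : L x = N x - x by rewrite LE' I0E scale1r rmorphN1 scaleN1r.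
have [K LK] := bop_rdot_bounded L.
(* With E' the spectral measure of [N], mu (L h) is (x - 1)^2 <E'(dx) h, h>, because L = N - I. *)
have op (E : set R) : measurable E -> exists S : bop H,
    forall h, inner (S h) h = (fine (mu (L h) E))%:C.
  move=> mE; apply: (@hermitian_quad_bop _ _ (fun h => fine (mu (L h) E)) (K ^+ 2)).
    exact: (hermitian_quad_comp (clinear_bop L) (muH E mE)).
  move=> x; rewrite fine_ge0//=; apply: le_trans (LK x).
  by rewrite -lee_fin -muT fineK ?fin_num_measure// le_measure ?inE.
have /choice[F FE] (E : set R) : exists S : bop H, measurable E ->
    forall h, inner (S h) h = (fine (mu (L h) (E `\ 1)))%:C.
  have [mE|nE] := pselect (measurable E); last by exists I0.
  by have [S SE] := op (E `\ 1) (measurableD mE (measurable_set1 1)); exists S.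
have F0 (E : set R) : measurable E -> (forall h, mu (L h) (E `\ 1) = 0%E) -> forall h, F E h = 0.
  move=> mE E0; have [FD _ Fi] := clinear_bop (F E); apply: inner_quad_eq0 => // h.
  by rewrite FE// E0.
(* Since Q_n(1) = n^2 / 2 - n / 2, half of the atom goes into [C] and is subtracted from [B]. *)
have [C2 C2E] := op [set 1] (measurable_set1 1).
have [C CE'] := bop_lincomb C2 C2 (2%:R^-1) 0.
have CE h : inner (C h) h = (fine (mu (L h) [set 1]) / 2%:R)%:C.
  by rewrite CE' scale0r addr0 innerZl C2E -rmorphM/= mulrC.
have [B BE'] := bop_lincomb L C 1 (-1).
have BE h : inner (B h) h = (rdot (L h) h - fine (mu (L h) [set 1]) / 2%:R)%:C.
  rewrite BE' scale1r rmorphN1 scaleN1r innerDl innerNl CE rmorphB/=; congr (_ - _).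
  rewrite (@selfadjoint_quad _ _ L)// => x y.
  by rewrite !LE innerDl innerNl symN innerDr innerNr.
have mRp : measurable (@Rplus R) by exact: measurable_itv.
exists B, C, F; split.
- exact: quad_real_selfadjoint BE.
- by move=> h; rewrite CE lecR divr_ge0// fine_ge0.
- split.
    move=> h; exists (mrestr (mu (L h)) (measurableC (measurable_set1 1))).
    by move=> E [mE _]; rewrite FE// setDE.
  exists `[0, M]%classic; split; first exact: segment_compact.
    by move=> x /=; rewrite /Rplus/= !in_itv/= => /andP[->].
  apply: F0; first exact: measurableD.
  move=> h; apply/eqP; rewrite -measure_le0 -(muC (L h)); apply: le_measure.
  + by rewrite inE; apply: measurableD => //; exact: measurableD.
  + by rewrite inE; exact: measurableC.
  + by move=> x [] [].
- by apply: F0 => // h; rewrite setDv measure0.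
move=> n; have [Nn NnE] := bop_iter N n.
(* [S] is defined by the required identity; what remains is that it is the integral of [Qpol n]. *)
have [S1 S1E] := bop_lincomb Nn I0 1 (-1).
have [S2 S2E] := bop_lincomb S1 B 1 (- n%:R).
have [S SE'] := bop_lincomb S2 C 1 (- (n ^ 2)%:R).
have SE x : S x = iter n N x - x - n%:R *: B x - (n ^ 2)%:R *: C x.
  rewrite SE' S2E S1E NnE I0E !scale1r !rmorphN rmorph1 !scaleNr scale1r.
  by rewrite !rmorph_nat.
exists S; last first.
  move=> x; rewrite SE.
  set u := n%:R *: B x; set v := (n ^ 2)%:R *: C x; set w := iter n N x.
  have -> : w - x - u - v = w - (x + u + v) by rewrite !opprD !addrA.
  by rewrite addrC subrK.
move=> h nu nuF.
have nuE (E : set R) : measurable E -> E `<=` @Rplus R -> nu E = mu (L h) (E `\ 1).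
  move=> mE sE; have := nuF E (conj mE sE); rewrite FE// => /eqP.
  rewrite eq_complex/= eqxx andbT => /eqP e.
  by rewrite -[LHS]fineK ?fin_num_measure// -e fineK// fin_num_measure//; exact: measurableD.
pose c j := rdot (iter j N h) h.
have sN := rdot_sym_bop.
(* <N^j (N - I) h, (N - I) h> is the second difference of [c], by symmetry of [N]. *)
have mom j : \int[mu (L h)]_(x in `[0, M]) (x ^+ j) = c j.+2 - c j.+1 *+ 2 + c j.
  have [ND _ _] := clinear_iter j (clinear_bop N).
  rewrite muX LE ND (clinearN (clinear_iter j (clinear_bop N))).
  by rewrite -iterSr rdotBl !rdotBr -!sN /c /=; lra.
have [iQ QE] := poly_integral M1 n.-1 (fun j => (n - j - 1)%:R) mom.
have mQ : measurable_fun [set: R] (Qpol n).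
  apply: measurable_sum => j; apply: measurable_funM => //; exact: exprn_measurable.
have [inu nuQ] := integral_remove_atom M1 (muC (L h)) nuE mQ iQ.
split => //; rewrite nuQ QE second_difference_sum Qpol_at1.
rewrite SE !innerDl !innerNl !innerZl BE CE.
have symI x y : inner (iter n N x) y = inner x (iter n N y).
  by elim: (n) x y => //= m IH x y; rewrite symN IH -iterSr.
rewrite (selfadjoint_quad symI) -[inner h h]/(inner (iter 0 N h) h) inner_norm norm_rdot.
rewrite -/(c n) -[rdot _ _]/(c 0%N) LE rdotBl -[rdot (N h) h]/(c 1%N) -[rdot h h]/(c 0%N).
rewrite -!(rmorph_nat (real_complex R)) -!rmorphM -!rmorphN -!rmorphD; congr (_%:C).
by rewrite natrX; field.
Qed.

End SpectralTriplet.

(** * Normal operators *)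

Section NormalOperators.
Variables (R : realType) (H : hilbertType R) (T : bop H).
Hypothesis normalT : normal_op T.
Implicit Types (x y h : H).

Lemma normal_adjoint : normal_op (adjoint T).
Proof. by move=> x; rewrite adjointK normalT. Qed.

(** By normality the adjoint of [T] commutes with [N], so that the innermost pair can be moved out
    step by step. *)
Lemma normal_iter (N : H -> H) n x : (forall x, N x = adjoint T (T x)) ->
  iter n (adjoint T) (iter n T x) = iter n N x.
Proof.
move=> NE; have comm m y : adjoint T (iter m N y) = iter m N (adjoint T y).
  by elim: m => //= m IH; rewrite !NE -IH normalT.
by elim: n x => // n IH x; rewrite iterS iterSr IH comm -NE -iterSr.
Qed.

Lemma inner_iter_adjoint n x y : inner (iter n T x) y = inner x (iter n (adjoint T) y).
Proof. by elim: n x y => //= n IH x y; rewrite adjointP IH -iterSr. Qed.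

(** A Gram sum: |T^(i+j) h|^2 = <N^i h, N^j h>, so the double sum is the squared norm of the
    combination of the N^i h with coefficients [lam i]. *)
Lemma normal_cpd : cpd T.
Proof.
move=> h k lam _; pose N x := adjoint T (T x).
have symN i x y : inner (iter i N x) y = inner x (iter i N y).
  elim: i x y => //= i IH x y.
  by rewrite /N inner_conj -adjointP -inner_conj adjointP -/(N y) IH -iterSr.
suff -> : \sum_(i < k.+1) \sum_(j < k.+1)
    (complex.Re (`|iter (i + j) T h| ^+ 2))%:C * lam i * Num.conj (lam j) =
  inner (\sum_(i < k.+1) lam i *: iter i N h) (\sum_(j < k.+1) lam j *: iter j N h).
  by rewrite inner_norm exprn_ge0.
have suml := linear_sumlz (dot H); have sumr := linear_sumr (dot H).
rewrite [RHS]suml; apply: eq_bigr => i _; rewrite [RHS]sumr; apply: eq_bigr => j _.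
rewrite -[RHS]/(inner _ _) innerZl innerZr.
rewrite norm_rdot/= -norm_rdot -inner_norm inner_iter_adjoint (@normal_iter N)// iterD -symN.
by rewrite -mulrA mulrC; ring.
Qed.

End NormalOperators.

Lemma normal_triplets (R : realType) (H : hilbertType R) (T : bop H) : normal_op T ->
  exists (B C : bop H) (F : set R -> bop H),
  representing_triplet T B C F /\ representing_triplet (adjoint T) B C F.
Proof.
move=> nT; have [N NE] := bop_comp (adjoint T) T.
have symN x y : inner (N x) y = inner x (N y).
  by rewrite !NE inner_conj -adjointP -inner_conj adjointP.
have rN x : rdot (N x) x = rdot (T x) (T x).
  by rewrite rdotC NE /rdot -adjointP.
have posN x : 0 <= rdot (N x) x by rewrite rN rdot_ge0.
have [K TK] := bop_rdot_bounded T.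
(* The [+ 1] puts the point 1 into [0, M]. *)
have M1 : 1 <= K ^+ 2 + 1 by rewrite lerDr sqr_ge0.
have leN x : rdot (N x) x <= (K ^+ 2 + 1) * rdot x x.
  by rewrite rN (le_trans (TK x))// ler_wpM2r ?rdot_ge0// lerDl.
have [B [C [F [sB pC sF F1 FS]]]] := spectral_triplet symN posN M1 leN.
exists B, C, F; split; split => // n; have [S Si SE] := FS n; exists S => // x.
  by rewrite (normal_iter nT n x NE).
rewrite (normal_iter (normal_adjoint nT) (N := N)) ?SE// => y.
by rewrite adjointK NE nT.
Qed.

Theorem proposition3p2 (R : realType) (H : hilbertType R) (T : bop H) :
  normal_op T <->
  [/\ cpd T, cpd (adjoint T)
    & exists (B C : bop H) (F : set R -> bop H),
        representing_triplet T B C F /\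
        representing_triplet (adjoint T) B C F].
Proof.
split=> [nT|[_ _ [B [C [F [[_ _ [sF _] _ FS] [_ _ _ _ FS']]]]]] x].
  split; [exact: normal_cpd|exact/normal_cpd/normal_adjoint|exact: normal_triplets].
(* At n = 1 the two products of [T] and its adjoint both equal I + B + C plus an integral of Q_1;
   the operators [S] and [S'] agree because they have the same quadratic form. *)
have [S Si /(_ x)] := FS 1; have [S' Si' /(_ x)] := FS' 1.
rewrite /= adjointK => -> ->; congr (_ + _); move: x.
suff -> : S = S' by [].
apply: bop_quad_inj => h; have [mu muF] := sF h.
by rewrite (Si h mu muF).2 (Si' h mu muF).2.
Qed.
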